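(* Let $r,\alpha>0$ be fixed, and let $\{\varphi^\epsilon\}_{0<\epsilon<\epsilon_0}$ be the family of small-amplitude periodic traveling wave profiles, with speeds $c(\epsilon)$ and fundamental periods $L_\epsilon$, of the Korteweg-de Vries-Burgers-Fisher equation $$u_t+\alpha uu_x+u_{xxx}=u_{xx}+ru(1-u)$$ described in the context. Then there exists $\overline{\epsilon}_0\in(0,\epsilon_0)$ sufficiently small such that, for every $\epsilon\in(0,\overline{\epsilon}_0)$, the periodic wave $u(x,t)=\varphi^\epsilon(x-c(\epsilon)t)$ is orbitally unstable in the periodic space $H^3_{\mathrm{per}}([0,L_\epsilon])$ under the flow of this equation.
   Context: The family of waves (known existence result of Folino, Naumkina and Plaza, obtained from a local subcritical Hopf bifurcation): for any fixed $r,\alpha>0$ there exist $\epsilon_0>0$ sufficiently small and a critical speed $c_0=-r$ such that the equation has a family of smooth real-valued periodic traveling wave solutions $u(x,t)=\varphi^\epsilon(x-c(\epsilon)t)$, indexed by $0<\epsilon<\epsilon_0$, with fundamental period $L_\epsilon=\frac{2\pi}{\sqrt r}+O(\epsilon)$ as $\epsilon\to0^+$, with amplitude growing like $\varphi^\epsilon,(\varphi^\epsilon)'=O(\sqrt\epsilon)$, and with speed $c(\epsilon)=-r+O(\epsilon)$, so that $c(\epsilon)\to c_0$ as $\epsilon\to0^+$. For each fixed $\epsilon\in(0,\epsilon_0)$ the periodic wave $\varphi^\epsilon$ is unique up to translations. For $L>0$, $H^3_{\mathrm{per}}([0,L])$ is the Sobolev space of $L$-periodic functions with norm $\|u\|_3^2=L\sum_{k\in\mathbb{Z}}(1+|k|^2)^3|\widehat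 u(k)|^2$, $\widehat u(k)=\frac1L\int_0^Le^{-\frac{2\pi i}{L}kx}u(x)\,dx$. Solutions of the nonlinear equation are real-valued. Orbital stability: a traveling wave $\varphi(x-ct)$ with fundamental period $L$ is orbitally stable in $X=H^3_{\mathrm{per}}([0,L])$ by the flow of the equation if for each $\varepsilon>0$ there exists $\delta>0$ such that whenever $\psi\in X$ satisfies $\inf_{\rho\in\mathbb{R}}\|\psi(\cdot)-\varphi(\cdot+\rho)\|_X<\delta$, the solution $u(x,t)$ with $u(0)=\psi$ exists globally and satisfies $\sup_{t>0}\inf_{\rho\in\mathbb{R}}\|u(\cdot,t)-\varphi(\cdot+\rho)\|_X<\varepsilon$. Otherwise it is orbitally unstable in $X$. *)

(* Defs.v *)
(* MathComp-Analysis; the real line is an arbitrary [R : realType]. *)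
From HB Require Import structures.
From mathcomp Require Export all_boot all_order all_algebra.
From mathcomp Require Export all_classical all_reals all_analysis.
From mathcomp Require Export complex.
Export Order.TTheory GRing.Theory Num.Theory.
Export numFieldNormedType.Exports.

Set Implicit Arguments.
Unset Strict Implicit.
Unset Printing Implicit Defensive.

#[export] Set Implicit Arguments.
#[export] Unset Strict Implicit.
#[export] Unset Printing Implicit Defensive.

Local Open Scope classical_set_scope.
Local Open Scope ring_scope.
Local Open Scope complex_scope.

(** * Periodic Sobolev spaces *)

(* Elements of the function spaces are represented by genuine functions
   [R -> R], not quotiented by a.e. equality; the norms below only see the
   a.e. class. *)
Definition L2per (R : realType) (L : R) (u : R -> R) : Prop :=
  [/\ periodic u L, measurable_fun [set: R] u &
      (@lebesgue_measure R).-integrable `[0, L] (fun x => (u x ^+ 2)%:E)].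

(* For real-valued [u], (1/L) int_0^L exp(- 2 pi i k x / L) u(x) dx, split into
   its real and imaginary parts. *)
Definition fourier_coef (R : realType) (L : R) (u : R -> R) (k : int) : R[i] :=
  (L^-1 * \int[@lebesgue_measure R]_(x in `[0, L])
            (cos (2 * pi / L * k%:~R * x) * u x))
  +i* (- (L^-1 * \int[@lebesgue_measure R]_(x in `[0, L])
            (sin (2 * pi / L * k%:~R * x) * u x))).

(* The weight is (1 + k^2)^s, with [k] the mode number, not the wave number. *)
Definition Hnorm (R : realType) (s : nat) (L : R) (u : R -> R) : \bar R :=
  ((L%:E * \esum_(k in [set: int])
      ((1 + k%:~R ^+ 2) ^+ s *
       (complex.Re (fourier_coef L u k) ^+ 2 +
        complex.Im (fourier_coef L u k) ^+ 2))%:E)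
   `^ 2^-1)%E.

Definition Hper (R : realType) (s : nat) (L : R) (u : R -> R) : Prop :=
  L2per L u /\ (Hnorm s L u < +oo)%E.

(* [g] represents the [j]-th (periodic, distributional) derivative of [f]. *)
Definition weak_deriv (R : realType) (L : R) (j : nat) (f g : R -> R) : Prop :=
  [/\ L2per L f, L2per L g &
      forall k : int, fourier_coef L g k =
        (0 +i* (2 * pi / L * k%:~R)) ^+ j * fourier_coef L f k].

(** * The equation and its flow *)

(* Time comes first: [u t] is the profile at time [t]. *)
Definition classical_solution (R : realType) (r alpha : R) (u : R -> R -> R)
    : Prop :=
  forall t x : R,
    derive1 (fun s => u s x) t + alpha * u t x * derive1 (u t) x
      + derive1n 3 (u t) x
    = derive1n 2 (u t) x + r * u t x * (1 - u t x).

(* Global strong solutions in C([0,oo); H^3) with time derivative taken in L^2,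
   the third space derivative of an H^3 function being only in L^2. *)
Definition global_solution (R : realType) (r alpha L : R) (u : R -> R -> R)
    : Prop :=
  [/\ forall t : R, 0 <= t -> Hper 3 L (u t),
      forall t : R, 0 <= t ->
        Hnorm 3 L (fun x => u s x - u t x)
          @[s --> within [set s | 0 <= s] (nbhs t)] --> 0%E &
      forall t : R, 0 <= t -> exists ux uxx uxxx : R -> R,
        [/\ weak_deriv L 1 (u t) ux, weak_deriv L 2 (u t) uxx,
            weak_deriv L 3 (u t) uxxx &
            Hnorm 0 L (fun x => (u (t + h) x - u t x) / h
                - (uxx x + r * u t x * (1 - u t x)
                   - alpha * u t x * ux x - uxxx x))
              @[h --> within [set h | 0 <= t + h] 0^'] --> 0%E]].

(** * Periodic traveling waves *)

Definition smooth (R : realType) (f : R -> R) : Prop :=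
  forall (n : nat) (x : R), derivable (derive1n n f) x 1.

Definition fundamental_period (R : realType) (f : R -> R) (L : R) : Prop :=
  [/\ 0 < L, periodic f L & forall T : R, 0 < T -> periodic f T -> L <= T].

Definition periodic_wave (R : realType) (r alpha c L : R) (phi : R -> R)
    : Prop :=
  [/\ smooth phi, fundamental_period phi L &
      classical_solution r alpha (fun t x => phi (x - c * t))].

Definition orbit_dist (R : realType) (L : R) (phi psi : R -> R) : \bar R :=
  ereal_inf [set Hnorm 3 L (fun x => psi x - phi (x + rho)) | rho in [set: R]].

Definition orbitally_stable (R : realType) (r alpha L : R) (phi : R -> R)
    : Prop :=
  forall e : R, 0 < e -> exists2 delta : R, 0 < delta &
    forall psi : R -> R, Hper 3 L psi -> (orbit_dist L phi psi < delta%:E)%E ->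
      exists u : R -> R -> R,
        [/\ global_solution r alpha L u, u 0 = psi &
            (ereal_sup
               [set orbit_dist L phi (u t) | t in [set t : R | (0 < t)%R]]
              < e%:E)%E].

Definition orbitally_unstable (R : realType) (r alpha L : R) (phi : R -> R)
    : Prop := ~ orbitally_stable r alpha L phi.

(** * The small-amplitude family *)

(* The uniqueness clause is the one of the Hopf theorem: it concerns the closed
   orbits in a fixed neighbourhood of the rest state u = 0 in the phase space
   (phi, phi', phi'') of the profile equation, at the given speed. *)
Definition hopf_family (R : realType) (r alpha eps0 : R) (c Lp : R -> R)
    (phi : R -> R -> R) : Prop :=
  [/\ forall eps : R, 0 < eps < eps0 ->
        periodic_wave r alpha (c eps) (Lp eps) (phi eps),
      (fun eps => Lp eps - 2 * pi / Num.sqrt r) =O_ (0^'+) (fun eps => eps),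
      (fun eps => c eps - (- r)) =O_ (0^'+) (fun eps => eps),
      exists M : R, \forall eps \near 0^'+, forall x : R,
        `|phi eps x| <= M * Num.sqrt eps /\
        `|derive1 (phi eps) x| <= M * Num.sqrt eps &
      exists2 eta : R, 0 < eta &
        forall eps : R, 0 < eps < eps0 -> forall (T : R) (psi : R -> R),
          periodic_wave r alpha (c eps) T psi ->
          (forall x : R, [/\ `|psi x| < eta, `|derive1 psi x| < eta &
                         `|derive1n 2 psi x| < eta]) ->
          exists rho : R, forall x : R, psi x = phi eps (x + rho)].

(* Main.v *)
From mathcomp Require Import ring lra measurable_realfun.
Require Import Defs.

(** A small wave is unstable because the state [u = 0], around which it
    oscillates, is: the mean of a solution grows there at the rate [r]. The
    remaining modes do not compete. The period is close to [2 * pi / sqrt r], so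
    that for the modes of frequency at least one the diffusion outweighs the
    growth [r] up to a small error, and the dispersion does not change the energy.

    Suppose that the wave [phi (x - c * t)] is stable, and let [u] be the solution
    that starts at [phi + d], with [d] a small positive constant, and stays near
    the orbit of the wave. Both are small for all times, at the scale of the
    amplitude. Hence [w = u - phi (x - c * t)], compared at the same time and not
    up to translation, is bounded and solves a linear equation
    [w_t + w_xxx = w_xx + r * w - alpha / 2 * (s * w)_x - r * s * w], where the sum
    [s] of the two solutions is small. Two observations follow.
    - The mean [a] of [w] satisfies [a' = r * a - r * mean (s * w)]. Being
      bounded, it is determined by the future of the forcing [s * w]; if [w] is
      bounded by a multiple of [expR (r / 2 * t)], then [a] is bounded by a small
      fraction of this multiple ([fast_growth_norm_le]).
    - The other modes vanish at time zero and, by an energy estimate, grow at a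
      slow rate; they are small in the same sense ([slow_growth_le]).
    So a bound on the [L^2] norm of [w] by [Z * expR (r / 2 * t)] improves to one
    with [Z / 2] ([contraction]), and [w] vanishes for positive times. As its mean
    is [d] at time zero, this is absurd ([small_pair_absurd]).

    The energy estimate is carried out on the Fourier coefficients, which obey
    ordinary differential equations ([modal_solution]). To go back and forth
    between a function and its coefficients one needs the completeness of the
    trigonometric system ([fourier_unique]): it shows that the norm of [H^3]
    controls the sup norm ([ae_bounded_of_Hnorm3]), that the modes control the
    [L^2] norm of [w] ([integ_sqr_le_of_modal_energy]), and that [u * u_x] is the
    weak derivative of [u ^ 2 / 2] ([coscoef_mul_deriv]). *)

Local Open Scope classical_set_scope.
Local Open Scope ring_scope.

(** * Integration over one period *)

Lemma continuous_fctM (R : realType) (f g : R -> R) :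
  continuous f -> continuous g -> continuous (fun x => f x * g x).
Proof. by move=> cf cg x; exact: (continuousM (cf x) (cg x)). Qed.

Lemma continuous_fctD (R : realType) (f g : R -> R) :
  continuous f -> continuous g -> continuous (fun x => f x + g x).
Proof. by move=> cf cg x; exact: (continuousD (cf x) (cg x)). Qed.

Lemma continuous_fctZ (R : realType) (a : R) (f : R -> R) :
  continuous f -> continuous (fun x => a * f x).
Proof. by move=> cf; apply: continuous_fctM => // x; exact: cst_continuous. Qed.

Lemma continuous_fctN (R : realType) (f : R -> R) :
  continuous f -> continuous (fun x => - f x).
Proof. by move=> cf x; exact: (continuousN (cf x)). Qed.

Section PeriodIntegral.
Context (R : realType) (L : R).
Implicit Types (f g h : R -> R) (a b M : R).

Local Notation mu := (@lebesgue_measure R).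

Definition integ f : R := \int[mu]_(x in `[0, L]) f x.

Definition intble f : Prop := mu.-integrable `[0, L] (EFin \o f).

Definition meas f : Prop := measurable_fun (`[0, L] : set R) f.

Definition square_intble f : Prop :=
  meas f /\ intble (fun x => f x ^+ 2).

Definition ae_period (P : R -> Prop) : Prop :=
  almost_everywhere mu (fun x : R => `[0, L]%classic x -> P x).

Lemma intble_meas f : intble f -> meas f.
Proof. by move=> /integrableP[/measurable_EFinP]. Qed.

Lemma continuous_meas f : continuous f -> meas f.
Proof.
by move=> cf; apply: measurable_funTS; exact: continuous_measurable_fun.
Qed.

Lemma continuous_intble f : continuous f -> intble f.
Proof.
move=> cf; apply: continuous_compact_integrable; first exact: segment_compact.
exact: continuous_subspaceT.
Qed.

Lemma continuous_bounded f : 0 <= L -> continuous f ->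
  exists M : R, forall x : R, x \in `[0, L] -> `|f x| <= M.
Proof.
move=> L0 cf.
have cn : {within `[0, L], continuous (fun x => `|f x|)}.
  apply: continuous_subspaceT => x.
  exact: (continuous_comp (cf x) (@norm_continuous _ _ _)).
by have [c _ h] := EVT_max L0 cn; exists `|f c|.
Qed.

Lemma intbleD f g : intble f -> intble g -> intble (fun x => f x + g x).
Proof.
move=> fi gi; have := @integrableD _ _ _ mu _ (measurable_itv `[0, L]) _ _ fi gi.
by apply: eq_integrable.
Qed.

Lemma intbleZ a f : intble f -> intble (fun x => a * f x).
Proof.
move=> fi; have := @integrableZl _ _ _ mu _ (measurable_itv `[0, L]) a _ fi.
by apply: eq_integrable.
Qed.

Lemma intbleN f : intble f -> intble (fun x => - f x).
Proof.
by move=> /(intbleZ (-1)); under eq_fun do rewrite mulN1r.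
Qed.

Lemma intbleB f g : intble f -> intble g -> intble (fun x => f x - g x).
Proof. by move=> fi gi; apply: intbleD => //; exact: intbleN. Qed.

Lemma intble_sum n (F : nat -> R -> R) :
  (forall k, intble (F k)) -> intble (fun x => \sum_(k < n) F k x).
Proof.
move=> Fi; elim: n => [|n IH].
  under eq_fun do rewrite big_ord0.
  by apply: continuous_intble => x; exact: cst_continuous.
by under eq_fun do rewrite big_ord_recr /=; exact: intbleD.
Qed.

Lemma intble_dominated f g : meas f -> intble g ->
  (forall x : R, x \in `[0, L] -> `|f x| <= g x) -> intble f.
Proof.
move=> mf gi fg; apply: (le_integrable _ _ _ gi) => //.
  exact/measurable_EFinP.
move=> x xL /=; rewrite lee_fin.
exact: le_trans (fg x xL) (ler_norm _).
Qed.

Lemma square_intbleM f g : square_intble f -> square_intble g ->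
  intble (fun x => f x * g x).
Proof.
move=> [mf fi] [mg gi].
apply: (intble_dominated _ (intbleD fi gi)); first exact: measurable_funM.
move=> x _; rewrite normrM; have := sqr_ge0 (`|f x| - `|g x|).
rewrite -(real_normK (num_real (f x))) -(real_normK (num_real (g x))).
have := normr_ge0 (f x); have := normr_ge0 (g x); nra.
Qed.

Lemma square_intbleD f g : square_intble f -> square_intble g ->
  square_intble (fun x => f x + g x).
Proof.
move=> hf hg; split; first by apply: measurable_funD; [case: hf|case: hg].
have hfg := square_intbleM hf hg; case: hf hg => _ fi [_ gi].
have := intbleD (intbleD fi gi) (intbleZ 2 hfg).
by congr intble; apply/funext => x; ring.
Qed.

Lemma square_intbleZ a f : square_intble f -> square_intble (fun x => a * f x).
Proof.
move=> [mf fi]; split; first exact: measurable_funM.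
by have := intbleZ (a ^+ 2) fi; congr intble; apply/funext => x; ring.
Qed.

Lemma square_intbleB f g : square_intble f -> square_intble g ->
  square_intble (fun x => f x - g x).
Proof.
move=> hf /(square_intbleZ (-1)) hg; have := square_intbleD hf hg.
by congr square_intble; apply/funext => x; ring.
Qed.

Lemma continuous_square_intble f : continuous f -> square_intble f.
Proof.
move=> cf; split; first exact: continuous_meas.
by apply: continuous_intble; exact: continuous_fctM.
Qed.

Lemma square_intble_intble f : square_intble f -> intble f.
Proof.
move=> hf.
have h1 : square_intble (fun=> 1).
  by apply: continuous_square_intble => x; exact: cst_continuous.
by have := square_intbleM hf h1; under eq_fun do rewrite mulr1.
Qed.

Lemma intble_boundedM f g M : meas g -> intble f ->
  (forall x : R, x \in `[0, L] -> `|g x| <= M) -> intble (fun x => g x * f x).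
Proof.
move=> mg fi gM.
have [mf af] : meas f /\ intble (fun x => `|f x|).
  by split; [exact: intble_meas | exact: integrable_norm].
apply: (intble_dominated _ (intbleZ M af)); first exact: measurable_funM.
by move=> x xL; rewrite normrM ler_wpM2r// gM.
Qed.

Lemma integD f g : intble f -> intble g ->
  integ (fun x => f x + g x) = integ f + integ g.
Proof. by move=> fi gi; rewrite /integ RintegralD. Qed.

Lemma integZ a f : intble f -> integ (fun x => a * f x) = a * integ f.
Proof. by move=> fi; rewrite /integ RintegralZl. Qed.

Lemma integN f : intble f -> integ (fun x => - f x) = - integ f.
Proof.
by move=> fi; under eq_fun do rewrite -mulN1r; rewrite integZ// mulN1r.
Qed.

Lemma integB f g : intble f -> intble g ->
  integ (fun x => f x - g x) = integ f - integ g.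
Proof. by move=> fi gi; rewrite /integ RintegralB. Qed.

Lemma integ_sum n (F : nat -> R -> R) : (forall k, intble (F k)) ->
  integ (fun x => \sum_(k < n) F k x) = \sum_(k < n) integ (F k).
Proof.
move=> Fi; elim: n => [|n IH].
  rewrite big_ord0; under eq_fun do rewrite big_ord0.
  by rewrite /integ Rintegral_cst// mul0r.
under eq_fun do rewrite big_ord_recr /=.
by rewrite integD ?IH ?big_ord_recr//; exact: intble_sum.
Qed.

Lemma ae_period_all (P : R -> Prop) : (forall x, P x) -> ae_period P.
Proof. by move=> HP; apply: aeW => x _. Qed.

Lemma ae_period_imp (P Q : R -> Prop) :
  (forall x, P x -> Q x) -> ae_period P -> ae_period Q.
Proof.
move=> PQ; apply: (@filterS _ _ (ae_filter_ringOfSetsType mu)) => x Px /Px.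
exact: PQ.
Qed.

Lemma ae_period_and (P Q : R -> Prop) :
  ae_period P -> ae_period Q -> ae_period (fun x => P x /\ Q x).
Proof.
apply: (@filterS2 _ _ (ae_filter_ringOfSetsType mu)) => x Px Qx xL.
by split; [exact: Px | exact: Qx].
Qed.

Lemma ae_period_integ_eq f g : meas f -> meas g ->
  ae_period (fun x => f x = g x) -> integ f = integ g.
Proof.
move=> mf mg fg; rewrite /integ /Rintegral; congr fine.
apply: ae_eq_integral => //; try exact/measurable_EFinP.
by apply: (@ae_period_imp (fun x => f x = g x) _ _ fg) => x ->.
Qed.

Lemma ae_period_integ_ge0 f : meas f -> ae_period (fun x => 0 <= f x) -> 0 <= integ f.
Proof.
move=> mf f0; rewrite (@ae_period_integ_eq f (fun x => `|f x|)) //.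
- by apply: Rintegral_ge0.
- by apply: measurableT_comp.
- by apply: ae_period_imp f0 => x fx; rewrite ger0_norm.
Qed.

Lemma ae_period_le_integ f g : intble f -> intble g ->
  ae_period (fun x => f x <= g x) -> integ f <= integ g.
Proof.
move=> fi gi fg; rewrite -subr_ge0 -integB//; apply: ae_period_integ_ge0.
  exact: intble_meas (intbleB gi fi).
by apply: ae_period_imp fg => x; rewrite subr_ge0.
Qed.

Hypothesis L_gt0 : 0 < L.

Lemma integ_cst a : integ (fun=> a) = a * L.
Proof.
rewrite /integ Rintegral_cst//; congr (_ * _).
have /= := @lebesgue_measure_itv R `[0, L]; rewrite lte_fin L_gt0 => h.
by rewrite -[RHS]subr0 -[RHS]/(fine (L%:E - 0%:E)%E) -h.
Qed.

Lemma intble_cst a : intble (fun=> a).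
Proof. by apply: continuous_intble => x; exact: cst_continuous. Qed.

Lemma ae_period_integ_norm f M : intble f -> ae_period (fun x => `|f x| <= M) ->
  `|integ f| <= M * L.
Proof.
move=> fi fM; rewrite ler_norml -mulNr -!integ_cst.
apply/andP; split; apply: ae_period_le_integ => //; try exact: intble_cst.
  by apply: ae_period_imp fM => x; rewrite ler_norml => /andP[].
by apply: ae_period_imp fM => x; rewrite ler_norml => /andP[].
Qed.

(** The bound on [g] holds only almost everywhere, so domination is applied to
    the square truncated at [M ^+ 2 * f x ^+ 2], which agrees with the square of
    the product almost everywhere. *)
Lemma square_intble_ae_boundedM f g M : meas g -> square_intble f ->
  ae_period (fun x => `|g x| <= M) -> square_intble (fun x => g x * f x).
Proof.
move=> mg [mf fi] gM; split; first exact: measurable_funM.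
have mgf : meas (fun x => (g x * f x) ^+ 2).
  by apply: measurable_funX; exact: measurable_funM.
have mi : intble (fun x => Num.min ((g x * f x) ^+ 2) (M ^+ 2 * f x ^+ 2)).
  apply: (intble_dominated _ (intbleZ (M ^+ 2) fi)).
    by apply: measurable_minr => //; apply: measurable_funM => //; exact: measurable_funX.
  move=> x _; rewrite ger0_norm; first by rewrite ge_min lexx orbT.
  by rewrite le_min sqr_ge0 mulr_ge0 ?sqr_ge0.
have e : ae_period (fun x => Num.min ((g x * f x) ^+ 2) (M ^+ 2 * f x ^+ 2)
                      = (g x * f x) ^+ 2).
  apply: ae_period_imp gM => x gM; apply/min_idPl.
  rewrite exprMn ler_wpM2r ?sqr_ge0// -(real_normK (num_real (g x))).
  by rewrite lerXn2r ?nnegrE// (le_trans _ gM).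
move: mi => /integrableP[mm mi]; apply/integrableP; split.
  exact/measurable_EFinP.
rewrite (_ : (\int[_]_(_ in _) _ = \int[mu]_(x in `[0%R, L])
  `|(Num.min ((g x * f x) ^+ 2) (M ^+ 2 * f x ^+ 2))%:E|)%E)//.
apply: ae_eq_integral => //.
- by apply: measurableT_comp => //; exact/measurable_EFinP.
- exact: measurableT_comp.
- by apply: ae_period_imp e => x /= ->.
Qed.

Lemma integ_derive (F f : R -> R) : continuous f ->
  (forall x : R, is_derive x 1 F (f x)) -> integ f = F L - F 0.
Proof.
move=> cf dF.
have cF : continuous F.
  by move=> x; apply/differentiable_continuous/derivable1_diffP; case: (dF x).
rewrite /integ /Rintegral (@continuous_FTC2 _ f F 0 L)//.
- exact: continuous_subspaceT.
- split.
  + by move=> x _; case: (dF x).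
  + exact/cvg_at_right_filter/cF.
  + exact/cvg_at_left_filter/cF.
- by move=> x _; rewrite derive1E; case: (dF x).
Qed.

End PeriodIntegral.

(** * Trigonometric modes, Bessel's inequality and identity *)

Section Modes.
Context (R : realType) (L : R).
Implicit Types (f g : R -> R) (j k : int) (n : nat).

Definition wavenum k : R := 2 * pi / L * k%:~R.
Definition cosm k (x : R) : R := cos (wavenum k * x).
Definition sinm k (x : R) : R := sin (wavenum k * x).

Definition coscoef f k : R := integ L (fun x => cosm k x * f x).
Definition sincoef f k : R := integ L (fun x => sinm k x * f x).

(** The reciprocal of the integral of [cosm k ^+ 2]. *)
Definition modeweight n : R := if n is 0%N then L^-1 else 2 / L.

(** For a real function the negative modes repeat the positive ones, so a real
    Fourier sum runs over natural numbers; the sine at frequency zero is zero. *)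
Definition trig_sum f n (x : R) : R :=
  \sum_(k < n) modeweight k * (coscoef f k * cosm k x + sincoef f k * sinm k x).

Definition modal_energy f n : R :=
  \sum_(k < n) modeweight k * (coscoef f k ^+ 2 + sincoef f k ^+ 2).

Lemma wavenum0 : wavenum 0 = 0. Proof. by rewrite /wavenum mulr0. Qed.
Lemma cosm0 x : cosm 0 x = 1. Proof. by rewrite /cosm wavenum0 mul0r cos0. Qed.
Lemma sinm0 x : sinm 0 x = 0. Proof. by rewrite /sinm wavenum0 mul0r sin0. Qed.

Lemma wavenumD j k : wavenum (j + k) = wavenum j + wavenum k.
Proof. by rewrite /wavenum rmorphD/= mulrDr. Qed.

Lemma wavenumN k : wavenum (- k) = - wavenum k.
Proof. by rewrite /wavenum rmorphN/= mulrN. Qed.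

Lemma cosmN k x : cosm (- k) x = cosm k x.
Proof. by rewrite /cosm wavenumN mulNr cosN. Qed.

Lemma sinmN k x : sinm (- k) x = - sinm k x.
Proof. by rewrite /sinm wavenumN mulNr sinN. Qed.

Lemma cosmD j k x : cosm (j + k) x = cosm j x * cosm k x - sinm j x * sinm k x.
Proof. by rewrite /cosm wavenumD mulrDl cosD. Qed.

Lemma sinmD j k x : sinm (j + k) x = sinm j x * cosm k x + cosm j x * sinm k x.
Proof. by rewrite /sinm wavenumD mulrDl sinD. Qed.

Lemma cosm_norm k x : `|cosm k x| <= 1. Proof. exact: cos_max. Qed.
Lemma sinm_norm k x : `|sinm k x| <= 1. Proof. exact: sin_max. Qed.

Lemma cosMcos j k x :
  cosm j x * cosm k x = 2^-1 * cosm (j + k) x + 2^-1 * cosm (j - k) x.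
Proof. rewrite !cosmD cosmN sinmN; lra. Qed.

Lemma sinMsin j k x :
  sinm j x * sinm k x = 2^-1 * cosm (j - k) x - 2^-1 * cosm (j + k) x.
Proof. rewrite !cosmD cosmN sinmN; lra. Qed.

Lemma sinMcos j k x :
  sinm j x * cosm k x = 2^-1 * sinm (j + k) x + 2^-1 * sinm (j - k) x.
Proof. rewrite !sinmD cosmN sinmN; lra. Qed.

Lemma is_derive_cosm k (x : R) : is_derive x 1 (cosm k) (- (wavenum k * sinm k x)).
Proof.
rewrite -[cosm k]/(fun y => cos (wavenum k * y)); apply: is_derive_eq.
by rewrite /sinm -[_%:A]/(_ * 1); ring.
Qed.

Lemma is_derive_sinm k (x : R) : is_derive x 1 (sinm k) (wavenum k * cosm k x).
Proof.
rewrite -[sinm k]/(fun y => sin (wavenum k * y)); apply: is_derive_eq.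
by rewrite /cosm -[_%:A]/(_ * 1); ring.
Qed.

Lemma continuous_cosm k : continuous (cosm k).
Proof.
move=> x; apply/differentiable_continuous/derivable1_diffP.
by case: (is_derive_cosm k x).
Qed.

Lemma continuous_sinm k : continuous (sinm k).
Proof.
move=> x; apply/differentiable_continuous/derivable1_diffP.
by case: (is_derive_sinm k x).
Qed.

Hypothesis L_gt0 : 0 < L.

Lemma wavenumL k : wavenum k * L = 2 * pi * k%:~R.
Proof. by rewrite /wavenum; field; rewrite gt_eqF. Qed.

Lemma cossin_2pi_int k (a : R) : cos (a + 2 * pi * k%:~R) = cos a
  /\ sin (a + 2 * pi * k%:~R) = sin a.
Proof.
have h (n : nat) (b : R) : cos (b + pi *+ 2 *+ n) = cos b
    /\ sin (b + pi *+ 2 *+ n) = sin b.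
  by split; apply: periodicn; [exact: cosD2pi | exact: sinD2pi].
have e (n : nat) : 2 * pi * n%:~R = pi *+ 2 *+ n :> R.
  by rewrite mulr_natl -pmulrn mulr_natr.
case: k => n; first by rewrite e.
have [h1 h2] := h n.+1 (a - pi *+ 2 *+ n.+1).
rewrite NegzE rmorphN/= mulrN e.
by move: h1 h2; rewrite subrK => -> ->.
Qed.

Lemma cosm_periodic k : periodic (cosm k) L.
Proof. by move=> x; rewrite /cosm mulrDr wavenumL (cossin_2pi_int k _).1. Qed.

Lemma sinm_periodic k : periodic (sinm k) L.
Proof. by move=> x; rewrite /sinm mulrDr wavenumL (cossin_2pi_int k _).2. Qed.

Lemma wavenum_neq0 k : k != 0 -> wavenum k != 0.
Proof.
move=> k0; have := pi_gt0 R => pi0.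
by rewrite /wavenum !mulf_neq0 ?invr_eq0 ?intr_eq0 ?(gt_eqF pi0) ?(gt_eqF L_gt0).
Qed.

Lemma intble_cosm k : intble L (cosm k).
Proof. exact/continuous_intble/continuous_cosm. Qed.

Lemma intble_sinm k : intble L (sinm k).
Proof. exact/continuous_intble/continuous_sinm. Qed.

Lemma integ_cosm k : integ L (cosm k) = if k == 0 then L else 0.
Proof.
case: eqVneq => [->|k0].
  by rewrite (funext cosm0 : cosm 0 = fun=> 1) integ_cst// mul1r.
have w0 := wavenum_neq0 k0.
have e : integ L (fun x => wavenum k * cosm k x) = 0.
  rewrite (integ_derive L_gt0 _ (is_derive_sinm k)).
  - by rewrite -[L in sinm k L]add0r sinm_periodic subrr.
  - exact/continuous_fctZ/continuous_cosm.
move/eqP: e; rewrite integZ; last exact: intble_cosm.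
by rewrite mulf_eq0 (negPf w0) => /eqP.
Qed.

Lemma integ_sinm k : integ L (sinm k) = 0.
Proof.
have [->|k0] := eqVneq k 0.
  by rewrite (funext sinm0 : sinm 0 = fun=> 0) integ_cst// mul0r.
have w0 := wavenum_neq0 k0.
have e : integ L (fun x => - (wavenum k * sinm k x)) = 0.
  rewrite (integ_derive L_gt0 _ (is_derive_cosm k)).
  - by rewrite -[L in cosm k L]add0r cosm_periodic subrr.
  - exact/continuous_fctN/continuous_fctZ/continuous_sinm.
move/eqP: e; rewrite integN; last by apply: intbleZ; exact: intble_sinm.
rewrite integZ; last exact: intble_sinm.
by rewrite oppr_eq0 mulf_eq0 (negPf w0) => /eqP.
Qed.

Lemma integ_cos_cos (j k : nat) :
  integ L (fun x => cosm j x * cosm k x) = if j == k then (modeweight k)^-1 else 0.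
Proof.
under eq_fun do rewrite cosMcos.
rewrite integD ?integZ; try by [exact: intble_cosm | apply: intbleZ; exact: intble_cosm].
rewrite !integ_cosm subr_eq0 -PoszD !eqz_nat addn_eq0.
case: (eqVneq j k) => [->|jk]; first case: k => [|k]/=.
- by rewrite invrK; lra.
- by rewrite mulr0 add0r; field; rewrite gt_eqF.
- case: eqP => [j0|_]; last by rewrite !mulr0 addr0.
  by case: eqP => [k0|_]; [rewrite j0 k0 eqxx in jk|rewrite !mulr0 addr0].
Qed.

Lemma integ_sin_sin (j k : nat) : integ L (fun x => sinm j x * sinm k x) =
  if (j == k) && (k != 0)%N then (modeweight k)^-1 else 0.
Proof.
under eq_fun do rewrite sinMsin.
rewrite integB ?integZ; try by [exact: intble_cosm | apply: intbleZ; exact: intble_cosm].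
rewrite !integ_cosm subr_eq0 -PoszD !eqz_nat addn_eq0.
case: (eqVneq j k) => [->|jk]; first case: k => [|k]/=.
- by rewrite subrr.
- by rewrite mulr0 subr0; field; rewrite gt_eqF.
- case: eqP => [j0|_]; last by rewrite !mulr0 subr0.
  by case: eqP => [k0|_]; [rewrite j0 k0 eqxx in jk|rewrite !mulr0 subr0].
Qed.

Lemma integ_sin_cos j k : integ L (fun x => sinm j x * cosm k x) = 0.
Proof.
under eq_fun do rewrite sinMcos.
rewrite integD ?integZ; try by [exact: intble_sinm | apply: intbleZ; exact: intble_sinm].
by rewrite !integ_sinm !mulr0 addr0.
Qed.

Lemma modeweight_gt0 n : 0 < modeweight n.
Proof. by case: n => [|n]/=; rewrite ?divr_gt0 ?invr_gt0. Qed.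

Lemma sincoef0 f : sincoef f 0 = 0.
Proof.
rewrite /sincoef; under eq_fun do rewrite sinm0 mul0r.
by rewrite integ_cst// mul0r.
Qed.

Lemma intble_cosmM f k : intble L f -> intble L (fun x => cosm k x * f x).
Proof.
move=> fi; apply: (intble_boundedM _ fi (fun x _ => cosm_norm k x)).
by apply: continuous_meas; exact: continuous_cosm.
Qed.

Lemma intble_sinmM f k : intble L f -> intble L (fun x => sinm k x * f x).
Proof.
move=> fi; apply: (intble_boundedM _ fi (fun x _ => sinm_norm k x)).
by apply: continuous_meas; exact: continuous_sinm.
Qed.

Lemma coscoefD f g k : intble L f -> intble L g ->
  coscoef (fun x => f x + g x) k = coscoef f k + coscoef g k.
Proof.
move=> fi gi; rewrite /coscoef; under eq_fun do rewrite mulrDr.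
by rewrite integD//; exact: intble_cosmM.
Qed.

Lemma sincoefD f g k : intble L f -> intble L g ->
  sincoef (fun x => f x + g x) k = sincoef f k + sincoef g k.
Proof.
move=> fi gi; rewrite /sincoef; under eq_fun do rewrite mulrDr.
by rewrite integD//; exact: intble_sinmM.
Qed.

Lemma coscoefZ a f k : intble L f ->
  coscoef (fun x => a * f x) k = a * coscoef f k.
Proof.
move=> fi; rewrite /coscoef; under eq_fun do rewrite mulrCA.
by rewrite integZ//; exact: intble_cosmM.
Qed.

Lemma sincoefZ a f k : intble L f ->
  sincoef (fun x => a * f x) k = a * sincoef f k.
Proof.
move=> fi; rewrite /sincoef; under eq_fun do rewrite mulrCA.
by rewrite integZ//; exact: intble_sinmM.
Qed.

Lemma coscoefB f g k : intble L f -> intble L g ->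
  coscoef (fun x => f x - g x) k = coscoef f k - coscoef g k.
Proof.
move=> fi gi; rewrite /coscoef; under eq_fun do rewrite mulrBr.
by rewrite integB//; exact: intble_cosmM.
Qed.

Lemma sincoefB f g k : intble L f -> intble L g ->
  sincoef (fun x => f x - g x) k = sincoef f k - sincoef g k.
Proof.
move=> fi gi; rewrite /sincoef; under eq_fun do rewrite mulrBr.
by rewrite integB//; exact: intble_sinmM.
Qed.

Lemma continuous_trig_sum f n : continuous (trig_sum f n).
Proof.
elim: n => [|n IH].
  have -> : trig_sum f 0 = fun=> 0 by apply/funext => y; rewrite /trig_sum big_ord0.
  by move=> x; exact: cst_continuous.
have -> : trig_sum f n.+1 = (fun y => trig_sum f n y + modeweight n *
    (coscoef f n * cosm n y + sincoef f n * sinm n y)).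
  by apply/funext => y; rewrite /trig_sum big_ord_recr.
apply: continuous_fctD => //; apply: continuous_fctZ.
by apply: continuous_fctD; apply: continuous_fctZ;
  [exact: continuous_cosm|exact: continuous_sinm].
Qed.

Lemma integ_trig_sumM f g n : intble L g ->
  integ L (fun x => trig_sum f n x * g x) = \sum_(k < n) modeweight k *
    (coscoef f k * coscoef g k + sincoef f k * sincoef g k).
Proof.
move=> gi.
rewrite (_ : (fun x => _) = (fun x => \sum_(k < n) modeweight k *
  (coscoef f k * (cosm k x * g x) + sincoef f k * (sinm k x * g x)))); last first.
  by apply/funext => x; rewrite mulr_suml; apply: eq_bigr => k _; ring.
have ci k := intble_cosmM k gi; have si k := intble_sinmM k gi.
rewrite (@integ_sum _ _ n (fun (k : nat) x => modeweight k *
  (coscoef f k * (cosm k x * g x) + sincoef f k * (sinm k x * g x)))); last first.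
  by move=> k; apply: intbleZ; apply: intbleD; exact: intbleZ.
apply: eq_bigr => k _.
by rewrite integZ ?integD ?integZ//; [apply: intbleZ|apply: intbleZ|
   apply: intbleD; apply: intbleZ].
Qed.

Lemma coscoef_trig_sum f (n k : nat) : (k < n)%N ->
  coscoef (trig_sum f n) k = coscoef f k.
Proof.
move=> kn; rewrite /coscoef; under eq_fun do rewrite mulrC.
rewrite integ_trig_sumM; last exact: intble_cosm.
rewrite (bigD1 (Ordinal kn))//= big1 ?addr0.
  rewrite /coscoef /sincoef integ_cos_cos integ_sin_cos eqxx.
  by rewrite mulr0 addr0 mulrCA divff ?mulr1// gt_eqF// modeweight_gt0.
move=> j jk; rewrite {2}/coscoef {2}/sincoef integ_cos_cos integ_sin_cos.
by rewrite ifF ?mulr0 ?addr0 ?mulr0//; apply/negbTE.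
Qed.

Lemma sincoef_trig_sum f (n k : nat) : (k < n)%N ->
  sincoef (trig_sum f n) k = sincoef f k.
Proof.
move=> kn; have [->|k0] := eqVneq k 0%N; first by rewrite !sincoef0.
rewrite {1}/sincoef; under eq_fun do rewrite mulrC.
rewrite integ_trig_sumM; last exact: intble_sinm.
have e (j : nat) : coscoef (sinm k) j = 0.
  by rewrite /coscoef; under eq_fun do rewrite mulrC; exact: integ_sin_cos.
rewrite (bigD1 (Ordinal kn))//= big1 ?addr0.
  rewrite e {2}/sincoef integ_sin_sin eqxx k0/=.
  by rewrite mulr0 add0r mulrCA divff ?mulr1// gt_eqF// modeweight_gt0.
move=> j jk; rewrite e {2}/sincoef integ_sin_sin.
by rewrite ifF ?mulr0 ?addr0 ?mulr0//; rewrite (_ : (_ == _) = false)//; apply/negbTE.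
Qed.

(** [trig_sum f n] is an orthogonal projection of [f]: the cross term and the
    square of the projection are both equal to the modal energy. *)
Lemma integ_sqr_sub_trig_sum f n : square_intble L f ->
  integ L (fun x => (f x - trig_sum f n x) ^+ 2)
  = integ L (fun x => f x ^+ 2) - modal_energy f n.
Proof.
move=> hf.
have hS := continuous_square_intble L (@continuous_trig_sum f n).
have fi := square_intble_intble hf; have Si := square_intble_intble hS.
have e1 : integ L (fun x => trig_sum f n x * f x) = modal_energy f n.
  by rewrite integ_trig_sumM//; apply: eq_bigr => k _; rewrite !expr2.
have e2 : integ L (fun x => trig_sum f n x * trig_sum f n x) = modal_energy f n.
  rewrite integ_trig_sumM//; apply: eq_bigr => k _.
  by rewrite coscoef_trig_sum// sincoef_trig_sum// !expr2.
rewrite (_ : (fun x => _ ^+ 2) = (fun x => f x ^+ 2 - 2 * (trig_sum f n x * f x)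
   + trig_sum f n x * trig_sum f n x)); last by apply/funext => x; ring.
have i1 := square_intbleM hS hf; have i2 := square_intbleM hS hS.
case: (hf) => _ f2.
rewrite integD ?integB ?integZ// ?e1 ?e2; first ring.
- exact: intbleZ.
- by apply: intbleB => //; exact: intbleZ.
Qed.

Lemma bessel f n : square_intble L f ->
  modal_energy f n <= integ L (fun x => f x ^+ 2).
Proof.
move=> hf; rewrite -subr_ge0 -integ_sqr_sub_trig_sum//.
by apply: Rintegral_ge0 => x _; exact: sqr_ge0.
Qed.

(** The half of Parseval's identity that Bessel's inequality does not give: a
    partial sum within [t] of [f] leaves out at most [t ^+ 2 * L] of its energy. *)
Lemma integ_sqr_le_modal_energy f n (t : R) : square_intble L f ->
  ae_period L (fun x => `|f x - trig_sum f n x| <= t) ->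
  integ L (fun x => f x ^+ 2) <= modal_energy f n + t ^+ 2 * L.
Proof.
move=> hf ft; rewrite -lerBlDl -integ_sqr_sub_trig_sum// -integ_cst//.
have hS := continuous_square_intble L (@continuous_trig_sum f n).
apply: ae_period_le_integ; last 1 first.
- apply: ae_period_imp ft => x ft; rewrite -(real_normK (num_real (f x - _))).
  by rewrite lerXn2r ?nnegrE// (le_trans _ ft).
- by case: (square_intbleB hf hS).
- exact: intble_cst.
Qed.

End Modes.

(** * Completeness of the trigonometric system *)

Section PeakPolynomials.
Context (R : realType).
Implicit Types (a b h y z : R) (n K : nat).

Lemma bernoulli_le h n : -1 <= h -> 1 + n%:R * h <= (1 + h) ^+ n.
Proof.
move=> h1; elim: n => [|n IH]; first by rewrite mul0r addr0 expr0.
have h0 : 0 <= 1 + h by lra.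
rewrite exprSr; apply: le_trans (ler_wpM2r h0 IH).
have := mulr_ge0 (ler0n R n) (sqr_ge0 h).
rewrite -natr1; nra.
Qed.

(** [n%:R * b ^+ n] is at most the sum of the [b ^+ k] for [k < n]. *)
Lemma natrM_expr_le b n : 0 <= b <= 1 -> n%:R * (1 - b) * b ^+ n <= 1 - b ^+ n.
Proof.
move=> /andP[b0 b1]; elim: n => [|n IH]; first by rewrite !mul0r expr0 subrr.
have := ler_wpM2l b0 IH.
have : b ^+ n.+1 <= 1 by apply: exprn_ile1.
rewrite -natr1 !exprS.
set p := b ^+ n; set m := n%:R; nra.
Qed.

(** With [b] the square root of [a], the sequence [n%:R * b ^+ n] is bounded
    and the remaining factor [b ^+ n] tends to zero. *)
Lemma natrM_expr_cvg0 a : 0 <= a < 1 -> n%:R * a ^+ n @[n --> \oo] --> 0.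
Proof.
move=> /andP[a0 a1]; pose b := Num.sqrt a.
have b0 : 0 <= b by exact: sqrtr_ge0.
have ab : a = b * b by rewrite -expr2 sqr_sqrtr.
have b1 : b < 1 by rewrite ltNge; apply/negP => b1; nra.
apply: (@squeeze_cvgr _ _ _ _ (fun=> 0) (fun n => b ^+ n * (1 - b)^-1)).
- apply: nearW => n; rewrite mulr_ge0 ?exprn_ge0//=.
  rewrite ab exprMn ler_pdivlMr ?subr_gt0//.
  have h1 : b ^+ n <= 1 by apply: exprn_ile1 => //; exact: ltW.
  have h0 : 0 <= b ^+ n by exact: exprn_ge0.
  have : n%:R * (1 - b) * b ^+ n <= 1 - b ^+ n by apply: natrM_expr_le; rewrite b0 ltW.
  move=> h; have := ler_wpM2l h0 h.
  set p := b ^+ n in h0 h1 h *; set m := n%:R in h *; nra.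
- exact: cvg_cst.
- rewrite -(mul0r (1 - b)^-1); apply: cvgM; last exact: cvg_cst.
  by apply: cvg_expr; rewrite ger0_norm.
Qed.

(** Raising [1 - y ^+ n] to a power of the order of [K ^ n] turns the threshold
    [1 / K] into a sharp one; the extra factor [n] settles the limit at the
    threshold itself. *)
Lemma peak_cvg K y : (1 < K)%N -> 0 <= y <= 1 ->
  (1 - y ^+ n) ^+ (n * K ^ n) @[n --> \oo]
    --> (if y < K%:R^-1 then 1 else 0 : R).
Proof.
move=> K1 /andP[y0 y1].
have K0 : 0 < K%:R :> R by rewrite ltr0n; exact: ltnW.
have yn0 n : 0 <= y ^+ n by exact: exprn_ge0.
have yn1 n : y ^+ n <= 1 by exact: exprn_ile1.
have e n : (n * K ^ n)%:R * y ^+ n = n%:R * (K%:R * y) ^+ n.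
  by rewrite natrM natrX exprMn mulrA.
case: ifPn => [yK|]; last rewrite -leNgt => yK.
- have a1 : 0 <= K%:R * y < 1.
    apply/andP; split; first by rewrite mulr_ge0// ltW.
    by rewrite mulrC -ltr_pdivlMr// div1r.
  apply: (@squeeze_cvgr _ _ _ _ (fun n => 1 - n%:R * (K%:R * y) ^+ n) (fun=> 1)).
  + apply: nearW => n; rewrite exprn_ile1 ?subr_ge0 ?gerBl ?andbT//.
    have := @bernoulli_le (- y ^+ n) (n * K ^ n).
    by rewrite mulrN e lerN2 => ->.
  + rewrite -[X in _ --> X]subr0; apply: cvgB; first exact: cvg_cst.
    exact: natrM_expr_cvg0.
  + exact: cvg_cst.
- have a1 : 1 <= K%:R * y by rewrite mulrC -ler_pdivrMr// div1r.
  apply: (@squeeze_cvgr _ _ _ _ (fun=> 0) (fun n => n.+1%:R^-1)).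
  + apply: nearW => n; rewrite exprn_ge0 ?subr_ge0//=.
    set m := (n * K ^ n)%N.
    have b : n.+1%:R <= (1 + y ^+ n) ^+ m.
      apply: le_trans (bernoulli_le _ _); last by rewrite (le_trans _ (yn0 n))// lerN10.
      rewrite e -natr1 addrC lerD2l ler_peMr//; exact: exprn_ege1.
    rewrite -[_^-1]mul1r ler_pdivlMr//.
    apply: (le_trans (ler_wpM2l _ b)); first by rewrite exprn_ge0 ?subr_ge0.
    rewrite -exprMn exprn_ile1//; have := yn0 n; have := yn1 n; nra.
  + exact: cvg_cst.
  + exact: cvg_harmonic.
Qed.

End PeakPolynomials.

Section Completeness.
Context (R : realType) (L : R).
Implicit Types (f g p : R -> R) (k : int) (n K : nat).
Local Notation mu := (@lebesgue_measure R).

Variable f : R -> R.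
Hypotheses (L_gt0 : 0 < L) (f_intble : intble L f).

(** The multipliers that make [f] orthogonal to all modes. They are stable under
    products with [cosm L 1] and [sinm L 1] by the addition formulas, so that as
    soon as [1] is one of them every trigonometric polynomial is one. *)
Definition modes_vanish (p : R -> R) : Prop := continuous p /\
  forall k, coscoef L (fun x => p x * f x) k = 0 /\
            sincoef L (fun x => p x * f x) k = 0.

Lemma continuous_intbleM p : continuous p -> intble L (fun x => p x * f x).
Proof.
move=> cp; have [M pM] := continuous_bounded (ltW L_gt0) cp.
by apply: (intble_boundedM _ f_intble pM); exact: continuous_meas.
Qed.

Lemma modes_vanishB p q : modes_vanish p -> modes_vanish q ->
  modes_vanish (fun x => p x - q x).
Proof.
move=> [cp hp] [cq hq]; split; first exact/continuous_fctD/continuous_fctN.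
move=> k; have [p1 p2] := hp k; have [q1 q2] := hq k.
under eq_fun do rewrite mulrBl.
by rewrite coscoefB ?sincoefB ?p1 ?p2 ?q1 ?q2 ?subrr//; exact: continuous_intbleM.
Qed.

Lemma modes_vanishZ (a : R) p : modes_vanish p -> modes_vanish (fun x => a * p x).
Proof.
move=> [cp hp]; split; first exact/continuous_fctZ.
move=> k; have [p1 p2] := hp k.
under eq_fun do rewrite -mulrA.
by rewrite coscoefZ ?sincoefZ ?p1 ?p2 ?mulr0//; exact: continuous_intbleM.
Qed.

Lemma modes_vanish_cos p : modes_vanish p -> modes_vanish (fun x => cosm L 1 x * p x).
Proof.
move=> [cp hp].
have ip := continuous_intbleM cp.
split; first by apply: continuous_fctM => //; exact: continuous_cosm.
move=> k; have [p1 p2] := hp (k + 1); have [q1 q2] := hp (k - 1).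
rewrite /coscoef /sincoef in p1 p2 q1 q2 *.
have e1 x : cosm L k x * (cosm L 1 x * p x * f x) =
    2^-1 * (cosm L (k + 1) x * (p x * f x)) + 2^-1 * (cosm L (k - 1) x * (p x * f x)).
  by have := cosMcos L k 1 x; set P := p x * f x; rewrite -mulrA -/P mulrA => ->; ring.
have e2 x : sinm L k x * (cosm L 1 x * p x * f x) =
    2^-1 * (sinm L (k + 1) x * (p x * f x)) + 2^-1 * (sinm L (k - 1) x * (p x * f x)).
  by have := sinMcos L k 1 x; set P := p x * f x; rewrite -mulrA -/P mulrA => ->; ring.
under eq_fun do rewrite e1.
rewrite integD ?integZ ?p1 ?q1 ?mulr0 ?addr0;
  try by [|exact: intble_cosmM|apply: intbleZ; exact: intble_cosmM].
split=> //.
under eq_fun do rewrite e2.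
by rewrite integD ?integZ ?p2 ?q2 ?mulr0 ?addr0;
  try by [|exact: intble_sinmM|apply: intbleZ; exact: intble_sinmM].
Qed.

Lemma modes_vanish_sin p : modes_vanish p -> modes_vanish (fun x => sinm L 1 x * p x).
Proof.
move=> [cp hp].
have ip := continuous_intbleM cp.
split; first by apply: continuous_fctM => //; exact: continuous_sinm.
move=> k; have [p1 p2] := hp (1 + k); have [q1 q2] := hp (1 - k).
rewrite /coscoef /sincoef in p1 p2 q1 q2 *.
have e1 x : cosm L k x * (sinm L 1 x * p x * f x) =
    2^-1 * (sinm L (1 + k) x * (p x * f x)) + 2^-1 * (sinm L (1 - k) x * (p x * f x)).
  have := sinMcos L 1 k x; set P := p x * f x.
  by rewrite -mulrA -/P mulrA (mulrC (cosm _ _ _)) => ->; ring.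
have e2 x : sinm L k x * (sinm L 1 x * p x * f x) =
    2^-1 * (cosm L (1 - k) x * (p x * f x)) - 2^-1 * (cosm L (1 + k) x * (p x * f x)).
  have := sinMsin L 1 k x; set P := p x * f x.
  by rewrite -mulrA -/P mulrA (mulrC (sinm L k x)) => ->; ring.
under eq_fun do rewrite e1.
rewrite integD ?integZ ?p2 ?q2 ?mulr0 ?addr0;
  try by [|exact: intble_sinmM|apply: intbleZ; exact: intble_sinmM].
split=> //.
under eq_fun do rewrite e2.
by rewrite integB ?integZ ?p1 ?q1 ?mulr0 ?subr0;
  try by [|exact: intble_cosmM|apply: intbleZ; exact: intble_cosmM].
Qed.

(** Half of [1 - cos (kappa * (x - x0))]: it vanishes exactly on the
    translates of [x0] by periods. *)
Definition arc_bump (x0 x : R) : R := (1 - cos (wavenum L 1 * (x - x0))) / 2.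

Lemma arc_bump_ge0_le1 x0 x : 0 <= arc_bump x0 x <= 1.
Proof.
rewrite /arc_bump; have := cos_geN1 (wavenum L 1 * (x - x0)).
by have := cos_le1 (wavenum L 1 * (x - x0)); lra.
Qed.

Lemma continuous_arc_bump x0 : continuous (arc_bump x0).
Proof.
have -> : arc_bump x0 = fun x => 2^-1 * (1 + - ((cosm L 1 x0 * cosm L 1 x
                                + sinm L 1 x0 * sinm L 1 x))).
  by apply/funext => x; rewrite /arc_bump mulrBr cosB /cosm /sinm; ring.
apply/continuous_fctZ/continuous_fctD; first by move=> x; exact: cst_continuous.
apply/continuous_fctN/continuous_fctD; apply: continuous_fctZ;
  [exact: continuous_cosm|exact: continuous_sinm].
Qed.

Lemma modes_vanish_arc_bump x0 p :
  modes_vanish p -> modes_vanish (fun x => arc_bump x0 x * p x).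
Proof.
move=> hp.
have -> : (fun x => arc_bump x0 x * p x) = (fun x => (2^-1 * p x -
    (2^-1 * cosm L 1 x0) * (cosm L 1 x * p x)) -
    (2^-1 * sinm L 1 x0) * (sinm L 1 x * p x)).
  by apply/funext => x; rewrite /arc_bump mulrBr cosB /cosm /sinm; ring.
apply: modes_vanishB; first apply: modes_vanishB.
- exact: modes_vanishZ.
- exact/modes_vanishZ/modes_vanish_cos.
- exact/modes_vanishZ/modes_vanish_sin.
Qed.

Hypothesis f_vanish : forall n : nat, coscoef L f n = 0 /\ sincoef L f n = 0.

Lemma modes_vanish1 : modes_vanish (fun=> 1).
Proof.
split; first by move=> x; exact: cst_continuous.
under eq_fun do rewrite mul1r; case=> n; first exact: f_vanish.
have [c s] := f_vanish n.+1; rewrite NegzE /coscoef /sincoef in c s *.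
under eq_fun do rewrite cosmN.
split=> //; under eq_fun do rewrite sinmN mulNr.
by rewrite integN ?s ?oppr0//; exact: intble_sinmM.
Qed.

Lemma modes_vanish_peak x0 n m :
  modes_vanish (fun x => (1 - arc_bump x0 x ^+ n) ^+ m).
Proof.
have hb p : modes_vanish p -> modes_vanish (fun x => arc_bump x0 x ^+ n * p x).
  move=> hp; elim: n => [|i IH].
    by under eq_fun do rewrite expr0 mul1r.
  by under eq_fun do rewrite exprS -mulrA; exact: modes_vanish_arc_bump.
elim: m => [|m IH]; first by under eq_fun do rewrite expr0; exact: modes_vanish1.
under eq_fun do rewrite exprS mulrBl mul1r.
by apply: modes_vanishB => //; exact: hb.
Qed.

(** The peak polynomials in the bump are multipliers, are bounded by [1], and
    tend pointwise to the indicator of a neighbourhood of [x0]. *)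
Lemma integ_arc_bump_lt x0 K : (1 < K)%N ->
  integ L (fun x => (if arc_bump x0 x < K%:R^-1 then 1 else 0) * f x) = 0.
Proof.
move=> K1; pose q n x : R := (1 - arc_bump x0 x ^+ n) ^+ (n * K ^ n).
pose F n x := (q n x * f x)%:E.
have mf : meas L f by exact: intble_meas.
have mq n : meas L (q n) by case: (modes_vanish_peak x0 n (n * K ^ n)) => cq _; exact: continuous_meas.
have mb : meas L (arc_bump x0) by apply: continuous_meas; exact: continuous_arc_bump.
have mF n : meas L (fun x => q n x * f x) by exact: measurable_funM (mq n) mf.
have F0 n : (\int[mu]_(x in `[0%R, L]) F n x = 0)%E.
  case: (modes_vanish_peak x0 n (n * K ^ n)) => cp /(_ 0)[+ _].
  rewrite /coscoef; under eq_fun do rewrite cosm0 mul1r.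
  rewrite /integ /Rintegral => h; rewrite -[LHS]fineK ?h//.
  by apply: integrable_fin_num => //; exact: continuous_intbleM.
have mlim : meas L (fun x => if arc_bump x0 x < K%:R^-1 then 1 else 0 : R).
  apply: measurable_fun_if => //; try exact: measurable_cst.
  by apply: measurable_fun_ltr => //; exact: measurable_cst.
have := @dominated_convergence _ _ _ mu `[0, L] (measurable_itv _) F
  (fun x => ((if arc_bump x0 x < K%:R^-1 then 1 else 0) * f x)%:E)
  (fun x => (`|f x|)%:E).
case.
- by move=> n; have /measurable_EFinP := mF n.
- have mg : meas L (fun x => (if arc_bump x0 x < K%:R^-1 then 1 else 0) * f x).
    exact: measurable_funM.
  by have /measurable_EFinP := mg.
- apply: aeW => x _; apply: cvg_EFin; first by apply: nearW.
  apply: cvgM; last exact: cvg_cst.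
  by apply: peak_cvg => //; exact: arc_bump_ge0_le1.
- exact: integrable_norm.
- apply: aeW => x n _; rewrite /F /= lee_fin normrM ler_piMl//.
  have /andP[b0 b1] := arc_bump_ge0_le1 x0 x.
  have h0 : 0 <= arc_bump x0 x ^+ n by exact: exprn_ge0.
  have h1 : arc_bump x0 x ^+ n <= 1 by exact: exprn_ile1.
  by rewrite ger0_norm ?exprn_ge0 ?exprn_ile1 ?subr_ge0 ?gerBl.
move=> _ _; rewrite (_ : [sequence _]_n = fun=> 0%E); last first.
  by apply/funext => n; rewrite /= F0.
move=> /(cvg_unique _ (cvg_cst 0%E)) => h.
by rewrite /integ /Rintegral -h.
Qed.

Lemma wavenum1_gt0 : 0 < wavenum L 1.
Proof. by rewrite /wavenum mulr1 divr_gt0// mulr_gt0// pi_gt0. Qed.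

(** On the period the bump has a single well, the one around [x0]. *)
Lemma arc_bump_lt_ball (x0 b : R) K : 0 < x0 < L -> (1 < K)%N ->
  0 < b <= pi / 2 -> b < wavenum L 1 * x0 -> b < wavenum L 1 * (L - x0) ->
  cos b = 1 - 2 * K%:R^-1 -> forall x : R, x \in `[0, L] ->
  (arc_bump x0 x < K%:R^-1) = (`|x0 - x| < b / wavenum L 1).
Proof.
move=> /andP[x00 x0L] K1 /andP[b0 b2] bx0 bL cb x; rewrite in_itv/= => /andP[xge xle].
have k0 := wavenum1_gt0; have pi0 := pi_gt0 R.
set k := wavenum L 1 in k0 bx0 bL *.
have kL : k * L = 2 * pi by rewrite /k wavenumL// mulr1.
pose t := `|k * (x - x0)|.
have t0 : 0 <= t by exact: normr_ge0.
have ct : cos (k * (x - x0)) = cos t by rewrite cos_norm.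
have tE : t = k * `|x0 - x| by rewrite /t normrM gtr0_norm// distrC.
have tb : t + b < 2 * pi.
  rewrite tE; have [h|h] := leP x0 x.
    by rewrite ler0_norm ?subr_le0//; nra.
  by rewrite gtr0_norm ?subr_gt0//; nra.
have -> : (`|x0 - x| < b / k) = (t < b) by rewrite tE ltr_pdivlMr// mulrC.
have -> : (arc_bump x0 x < K%:R^-1) = (cos b < cos t).
  by rewrite /arc_bump -/k ct cb; apply/idP/idP => h; lra.
have [tpi|pit] := leP t pi.
  by rewrite ltr_cos// in_itv/=; apply/andP; split=> //; lra.
have -> : cos t = cos (2 * pi - t).
  rewrite -[in RHS]cosN opprB; have -> : 2 * pi = pi *+ 2 :> R by rewrite mulr_natl.
  by rewrite -[in LHS](subrK (pi *+ 2) t) cosD2pi.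
rewrite ltr_cos ?in_itv/=; try by apply/andP; split; lra.
by apply/idP/idP => h; exfalso; lra.
Qed.

(** The level sets of the bump below [1 / K] are the balls on which the cosine
    exceeds [1 - 2 / K]; they shrink to [x0] as [K] grows. *)
Lemma small_ball_integ0 (x0 e : R) : 0 < x0 < L -> 0 < e ->
  exists rho : R, [/\ 0 < rho, rho < e,
    ball x0 rho `<=` `[0, L]%classic &
    \int[mu]_(x in ball x0 rho) f x = 0].
Proof.
move=> x0L e0; have /andP[x00 xL] := x0L.
have k0 := wavenum1_gt0; set k := wavenum L 1 in k0 *.
have pi0 := pi_gt0 R.
have ke0 : 0 < k * e by rewrite mulr_gt0.
have kx0 : 0 < k * x0 by rewrite mulr_gt0.
have kL0 : 0 < k * (L - x0) by rewrite mulr_gt0// subr_gt0.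
have [b [b0 bpi be bx bL]] : exists b : R,
    [/\ 0 < b, b <= pi / 2, b < k * e, b < k * x0 & b < k * (L - x0)].
  (* The angle must stay below those of the two end points, since the cosine
     takes the value 1 again one period away from [x0]. *)
  pose m := Num.min (Num.min pi (k * e)) (Num.min (k * x0) (k * (L - x0))).
  have m0 : 0 < m by rewrite !lt_min pi0 ke0 kx0 kL0.
  have : m <= m by []; rewrite {2}/m !le_min => /andP[/andP[h1 h2] /andP[h3 h4]].
  by exists (m / 2); split; lra.
have cb1 : cos b < 1.
  by rewrite -cos0 ltr_cos ?in_itv/= ?lexx ?pi_ge0//; apply/andP; split; lra.
have cb0 : -1 <= cos b by exact: cos_geN1.
pose K := (Num.bound (2 / (1 - cos b))).+2.
have KE : 2 / (1 - cos b) < K%:R.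
  apply: lt_le_trans (archi_boundP _) _; first by rewrite divr_ge0// subr_ge0 ltW.
  by rewrite ler_nat /K ltnW.
have K0 : 0 < K%:R :> R by rewrite ltr0n.
have K2 : 2 <= K%:R :> R by rewrite ler_nat.
pose c : R := 1 - 2 * K%:R^-1.
have cbc : cos b < c.
  have : 2 * K%:R^-1 < 1 - cos b.
    by rewrite ltr_pdivrMr// mulrC -ltr_pdivrMr// subr_gt0.
  by rewrite /c; lra.
have Ki : K%:R^-1 <= 2^-1 :> R by rewrite lef_pV2 ?posrE.
have Ki0 : 0 < K%:R^-1 :> R by rewrite invr_gt0.
have c11 : -1 <= c <= 1 by rewrite /c; lra.
pose be' := acos c.
have ca : cos be' = c by rewrite /be' acosK// in_itv.
have be0 : 0 < be' by rewrite /be' acos_gt0//; rewrite /c; lra.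
have bepi : be' <= pi by rewrite /be' acos_lepi.
have beb : be' < b.
  by rewrite -ltr_cos ?ca ?in_itv//=; apply/andP; split; lra.
have hb := @arc_bump_lt_ball x0 be' K x0L isT.
have {}hb := hb _ (lt_trans beb bx) (lt_trans beb bL) ca.
have {}hb : forall x : R, x \in `[0, L] ->
    (arc_bump x0 x < K%:R^-1) = (`|x0 - x| < be' / k).
  by apply: hb; rewrite be0/=; lra.
pose rho := be' / k.
have rho_lt (y : R) : b < k * y -> rho < y.
  by move=> by_; rewrite /rho ltr_pdivrMr// mulrC (lt_trans beb).
have sub : ball x0 rho `<=` `[0, L]%classic.
  move=> x; rewrite /ball/= ltr_norml => /andP[h1 h2].
  by rewrite in_itv/=; have := rho_lt _ bx; have := rho_lt _ bL; lra.
exists rho; split=> //; first by rewrite divr_gt0.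
  exact: rho_lt.
rewrite -(@integ_arc_bump_lt x0 K isT) -[X in Rintegral _ X _](setIidr sub).
rewrite Rintegral_mkcondr; apply: eq_Rintegral => x; rewrite inE/= => xL'.
rewrite patchE hb// -/rho.
case: (boolP (`|x0 - x| < rho)) => h; first by rewrite mem_set// mul1r.
by rewrite memNset ?mul0r// => /(negP h).
Qed.

(** At a Lebesgue point of [f] the mean oscillation over small balls tends to
    zero, whereas on the balls of [small_ball_integ0], where [f] has mean zero,
    it is at least the absolute value of [f] at the centre. *)
Lemma fourier_unique : ae_period L (fun x => f x = 0).
Proof.
pose g := f \_ `[0, L].
have ig : mu.-integrable setT (EFin \o g).
  have := (@integrable_mkcond _ _ _ mu `[0, L] (EFin \o f) (measurable_itv _)).1 f_intble.
  by rewrite restrict_EFin.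
have lg := lebesgue_differentiation (open_integrable_locally openT ig).
have key (x : R) : lebesgue_pt g x -> x != 0 -> x != L -> `[0, L]%classic x -> f x = 0.
  move=> lx xn0 xnL; rewrite /= in_itv/= => /andP[x0 xL].
  have xx : 0 < x < L by rewrite !lt_neqAle eq_sym xn0 x0 xnL xL.
  have gx : g x = f x by rewrite /g patchE mem_set//= in_itv/= x0 xL.
  apply/eqP; rewrite -normr_eq0; apply/negPn/negP => fx0.
  have {}fx0 : 0 < `|f x| by rewrite lt_def fx0 normr_ge0.
  have h0 : \forall r \near (0:R)^'+, (davg g x r < (`|f x|)%:E)%E.
    apply: (lx [set y : \bar R | (y < `|f x|%:E)%E]); apply: open_nbhs_nbhs.
    by split; [exact: open_ereal_lt_ereal | rewrite /= lte_fin].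
  move: h0; rewrite near_withinE => /nbhs_ballP[d /= d0 hd].
  have [rho [rho0 rhod sub frho]] := small_ball_integ0 xx d0.
  have /hd/(_ rho0) : ball (0 : R) d rho by rewrite /ball/= sub0r normrN gtr0_norm.
  rewrite /davg /iavg lebesgue_measure_ball ?ltW// inver.
  rewrite mulrn_eq0/= (gt_eqF rho0)/=.
  have mB : measurable (ball x rho : set (measurableTypeR R)) by exact: measurable_ball.
  have igB : mu.-integrable (ball x rho) (EFin \o g).
    by apply: integrableS ig.
  have icB : mu.-integrable (ball x rho) (EFin \o (fun=> g x)).
    apply: measurable_bounded_integrable => //; last exact: bounded_cst.
    have : (@lebesgue_measure R (ball x rho) < +oo)%E.
      by rewrite lebesgue_measure_ball ?ltW// ltry.
    by [].
  have iB : mu.-integrable (ball x rho) (EFin \o (fun y => g y - g x)).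
    have := @integrableB _ _ _ mu _ mB _ _ igB icB.
    by apply: eq_integrable.
  have h1 : \int[mu]_(y in ball x rho) (g y - g x) = - (f x * (rho *+ 2)).
    rewrite RintegralB// Rintegral_cst//.
    have -> : fine (mu (ball x rho)) = rho *+ 2.
      by have -> := lebesgue_measure_ball x (ltW rho0).
    rewrite gx -[RHS]add0r; congr (_ - _); rewrite -[RHS]frho.
    apply: eq_Rintegral => y; rewrite inE => /sub yL.
    by rewrite /g patchE mem_set.
  have := le_normr_Rintegral mB iB; rewrite h1 normrN normrM => h2.
  have -> : (\int[mu]_(y in ball x rho) `|((center (g x) \o g) y)%:E|)%E
      = (\int[mu]_(y in ball x rho) `|g y - g x|)%:E.
    rewrite /Rintegral fineK//; apply: integrable_fin_num => //.
    exact: integrable_norm.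
  rewrite -EFinM lte_fin ltNge => /negP; apply.
  rewrite mulrC ler_pdivlMr ?pmulrn_lgt0//; apply: le_trans h2.
  by rewrite (@ger0_norm _ (rho *+ 2))// mulrn_wge0// ltW.
have n0 : mu.-negligible [set 0 : R] by exists [set 0]; split => //; exact: lebesgue_measure_set1.
have nL : mu.-negligible [set L] by exists [set L]; split => //; exact: lebesgue_measure_set1.
have ae0 : almost_everywhere mu (fun x : R => x != 0).
  by apply: negligibleS n0 => x /= /negP; rewrite negbK => /eqP.
have aeL : almost_everywhere mu (fun x : R => x != L).
  by apply: negligibleS nL => x /= /negP; rewrite negbK => /eqP.
have F := ae_filter_ringOfSetsType mu.
have a1 := @filterI _ _ F _ _ ae0 aeL.
apply: (@filterS2 _ _ F _ _ _ _ lg a1) => x lx [x0 xL] xin.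
exact: key.
Qed.

End Completeness.

(** * Uniform convergence of Fourier series with decaying coefficients *)

Lemma eq0_of_le_harmonic (R : realType) (a M : R) :
  (forall n : nat, `|a| <= M / n.+1%:R) -> a = 0.
Proof.
move=> h; apply/eqP; rewrite -normr_le0.
have c : M / n.+1%:R @[n --> \oo] --> (0 : R).
  rewrite -[0](mulr0 M); apply: cvgM; first exact: cvg_cst.
  exact: cvg_harmonic.
by apply: (ler_cvg_to (cvg_cst `|a|) c); exact: nearW.
Qed.

Lemma le_of_le_addr_harmonic (R : realType) (a b M : R) : 0 <= M ->
  (forall n : nat, a <= b + M / n.+1%:R) -> a <= b.
Proof.
move=> M0 h.
have c : b + M / n.+1%:R @[n --> \oo] --> b.
  rewrite -[X in _ --> X]addr0; apply: cvgD; first exact: cvg_cst.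
  rewrite -[0](mulr0 M); apply: cvgM; first exact: cvg_cst.
  exact: cvg_harmonic.
by apply: (ler_cvg_to (cvg_cst a) c); exact: nearW.
Qed.

Section Decay.
Context (R : realType) (L : R).
Implicit Types (f g : R -> R) (n m : nat).
Hypothesis L_gt0 : 0 < L.

(** The coefficients of an [H^3] function and of its first derivative decay at
    least at this rate, whose summability gives uniform convergence of the
    Fourier series. *)
Definition coef_decay (B : R) f : Prop := 0 <= B /\ forall n,
  coscoef L f n ^+ 2 + sincoef L f n ^+ 2 <= (B / (1 + n%:R ^+ 2)) ^+ 2.

(** Times [n.+1%:R^-1], this bounds the uniform error of the n-th partial sum;
    the case [n = 0] is a sup bound for the function itself. *)
Definition tail_cst (B : R) : R := 16 * B / L.

Lemma tail_cst_ge0 B f : coef_decay B f -> 0 <= tail_cst B.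
Proof. by move=> [B0 _]; rewrite /tail_cst divr_ge0 ?mulr_ge0// ltW. Qed.

Lemma modeweight_le n : modeweight L n <= 2 / L.
Proof.
case: n => [|n]//=; rewrite ler_peMl ?invr_ge0 ?ltW//; lra.
Qed.

(** The comparison with a telescoping term replaces the sum of a series. *)
Lemma inv_onem_sqr_le n :
  (1 + n%:R ^+ 2)^-1 <= 4 * (n.+1%:R^-1 - n.+2%:R^-1) :> R.
Proof.
have h1 : 0 < n.+1%:R :> R by [].
have h2 : 0 < n.+2%:R :> R by [].
have -> : n.+1%:R^-1 - n.+2%:R^-1 = (n.+1%:R * n.+2%:R)^-1 :> R.
  have e : n.+2%:R = n.+1%:R + 1 :> R by rewrite natr1.
  rewrite e in h2 *; move: h1 h2; set a := n.+1%:R => h1 h2.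
  by field; rewrite !gt_eqF.
have h3 : 0 < 1 + n%:R ^+ 2 :> R by rewrite ltr_pwDl// sqr_ge0.
rewrite -[leLHS]mul1r ler_pdivrMr// mulrAC ler_pdivlMr ?mulr_gt0// mul1r.
rewrite -(natr1 n.+1) -(natr1 n).
by have := sqr_ge0 (n%:R - 1 : R); have := ler0n R n; nra.
Qed.

Lemma trig_term_le B f n x : coef_decay B f ->
  `|modeweight L n * (coscoef L f n * cosm L n x + sincoef L f n * sinm L n x)|
  <= tail_cst B * (n.+1%:R^-1 - n.+2%:R^-1).
Proof.
move=> [B0 hB]; set b := B / (1 + n%:R ^+ 2).
have b0 : 0 <= b by rewrite /b divr_ge0// addr_ge0 ?sqr_ge0.
have cb : `|coscoef L f n| <= b.
  rewrite -(ler_pXn2r (n := 2)) ?nnegrE// real_normK ?num_real//.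
  by apply: le_trans (hB n); rewrite lerDl sqr_ge0.
have sb : `|sincoef L f n| <= b.
  rewrite -(ler_pXn2r (n := 2)) ?nnegrE// real_normK ?num_real//.
  by apply: le_trans (hB n); rewrite lerDr sqr_ge0.
have h : `|coscoef L f n * cosm L n x + sincoef L f n * sinm L n x| <= b + b.
  apply: le_trans (ler_normD _ _) _; rewrite !normrM; apply: lerD.
    by rewrite -[b]mulr1; apply: ler_pM => //; exact: cosm_norm.
  by rewrite -[b]mulr1; apply: ler_pM => //; exact: sinm_norm.
rewrite normrM gtr0_norm ?modeweight_gt0//.
apply: (le_trans (ler_pM _ _ (modeweight_le n) h)) => //.
  exact/ltW/modeweight_gt0.
have := inv_onem_sqr_le n; set d := _ - _ => hd.
have -> : tail_cst B * d = 2 / L * (2 * B * (4 * d)) by rewrite /tail_cst; field; rewrite gt_eqF.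
apply: ler_wpM2l; first by rewrite divr_ge0// ltW.
have -> : b + b = 2 * B * (1 + n%:R ^+ 2)^-1 by rewrite /b; lra.
by rewrite ler_wpM2l// mulr_ge0.
Qed.

Lemma trig_sum_sub_le B f n m x : coef_decay B f -> (n <= m)%N ->
  `|trig_sum L f m x - trig_sum L f n x|
    <= tail_cst B * (n.+1%:R^-1 - m.+1%:R^-1).
Proof.
move=> hB; elim: m => [|m IH].
  by rewrite leqn0 => /eqP ->; rewrite !subrr normr0 mulr0.
rewrite leq_eqVlt => /predU1P[->|]; first by rewrite !subrr normr0 mulr0.
rewrite ltnS => /IH h; rewrite /trig_sum big_ord_recr/= -/(trig_sum L f m x).
rewrite -addrA [_ - trig_sum _ _ _ _]addrC addrA.
apply: le_trans (ler_normD _ _) _.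
apply: le_trans (lerD h (trig_term_le m x hB)) _.
by rewrite -mulrDr addrA subrK.
Qed.

Lemma trig_sum_sub_le_harmonic B f n m x : coef_decay B f -> (n <= m)%N ->
  `|trig_sum L f m x - trig_sum L f n x| <= tail_cst B / n.+1%:R.
Proof.
move=> hB nm; apply: le_trans (trig_sum_sub_le x hB nm) _.
by rewrite ler_wpM2l ?(tail_cst_ge0 hB)// gerBl.
Qed.

Lemma trig_sum_bounded B f n x : coef_decay B f ->
  `|trig_sum L f n x| <= tail_cst B.
Proof.
move=> hB; have := trig_sum_sub_le_harmonic x hB (leq0n n).
by rewrite {2}/trig_sum big_ord0 subr0 divr1.
Qed.

Definition fourier_sum f (x : R) : R := limn (fun n => trig_sum L f n x).

Lemma fourier_sum_cvg B f x : coef_decay B f ->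
  trig_sum L f n x @[n --> \oo] --> fourier_sum f x.
Proof.
move=> hB; apply/cauchy_cvgP/cauchy_exP => e /= e0.
have c : tail_cst B / n.+1%:R @[n --> \oo] --> (0 : R).
  rewrite -[0](mulr0 (tail_cst B)); apply: cvgM; first exact: cvg_cst.
  exact: cvg_harmonic.
have [N _ hN] := cvgr_lt _ c _ e0.
exists (trig_sum L f N x), N => //= m /= Nm.
rewrite /ball/= distrC; apply: le_lt_trans (hN N (leqnn N)).
exact: trig_sum_sub_le_harmonic.
Qed.

Lemma fourier_sum_approx B f n x : coef_decay B f ->
  `|fourier_sum f x - trig_sum L f n x| <= tail_cst B / n.+1%:R.
Proof.
move=> hB.
have c : `|trig_sum L f m x - trig_sum L f n x| @[m --> \oo] -->
    `|fourier_sum f x - trig_sum L f n x|.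
  apply: cvg_norm; apply: cvgB; last exact: cvg_cst.
  exact: fourier_sum_cvg hB.
apply: (cvgr_to_le c); exists n => // m /= nm.
exact: trig_sum_sub_le_harmonic.
Qed.

Lemma fourier_sum_meas B f : coef_decay B f -> meas L (fourier_sum f).
Proof.
move=> hB; apply: (measurable_fun_cvg (h := trig_sum L f)).
  by move=> m; apply: continuous_meas; exact: continuous_trig_sum.
by move=> x _; exact: fourier_sum_cvg hB.
Qed.

Lemma fourier_sum_intble B f : coef_decay B f -> intble L (fourier_sum f).
Proof.
move=> hB; apply: (intble_dominated (fourier_sum_meas hB)
  (intble_cst L (tail_cst B))) => x _.
have := fourier_sum_approx 0 x hB.
by rewrite /trig_sum big_ord0 subr0 divr1.
Qed.

(** Uniform convergence allows termwise integration. *)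
Lemma fourier_sum_coef B f n : coef_decay B f ->
  coscoef L (fourier_sum f) n = coscoef L f n /\
  sincoef L (fourier_sum f) n = sincoef L f n.
Proof.
move=> hB; have gi := fourier_sum_intble hB.
have si m : intble L (trig_sum L f m).
  by apply: continuous_intble; exact: continuous_trig_sum.
have T0 := tail_cst_ge0 hB.
have bd (e : R -> R) m : (forall x, `|e x| <= 1) ->
    ae_period L (fun x => `|e x * (fourier_sum f x - trig_sum L f m x)|
       <= tail_cst B / m.+1%:R).
  move=> e1; apply: ae_period_all => x; rewrite normrM -[leRHS]mul1r.
  by apply: ler_pM => //; exact: fourier_sum_approx.
have tail (m : nat) : (n <= m)%N -> tail_cst B / m.+1%:R <= tail_cst B / n.+1%:R.
  by move=> nm; rewrite ler_wpM2l// lef_pV2 ?posrE// ler_nat.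
have step (m : nat) : tail_cst B / (n + m).+1%:R * L <= tail_cst B * L / m.+1%:R.
  rewrite mulrAC; apply: ler_wpM2l; first by rewrite mulr_ge0// ltW.
  by rewrite lef_pV2 ?posrE// ler_nat ltnS leq_addl.
split; apply/eqP; rewrite -subr_eq0; apply/eqP;
  apply: (@eq0_of_le_harmonic _ _ (tail_cst B * L)) => m; apply: le_trans (step m).
- have nm : (n < (n + m).+1)%N by rewrite ltnS leq_addr.
  rewrite -(coscoef_trig_sum L_gt0 f nm) -coscoefB//.
  apply: (ae_period_integ_norm L_gt0).
    by apply: intble_cosmM => //; exact: intbleB.
  apply: ae_period_imp (bd _ (n + m).+1 (cosm_norm L n)) => x /le_trans; apply.
  by rewrite ler_wpM2l// lef_pV2 ?posrE// ler_nat.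
- have nm : (n < (n + m).+1)%N by rewrite ltnS leq_addr.
  rewrite -(sincoef_trig_sum L_gt0 f nm) -sincoefB//.
  apply: (ae_period_integ_norm L_gt0).
    by apply: intble_sinmM => //; exact: intbleB.
  apply: ae_period_imp (bd _ (n + m).+1 (sinm_norm L n)) => x /le_trans; apply.
  by rewrite ler_wpM2l// lef_pV2 ?posrE// ler_nat.
Qed.

(** [f] and its Fourier sum have the same coefficients, hence agree almost
    everywhere by [fourier_unique]. *)
Lemma ae_trig_sum_approx B f n : intble L f -> coef_decay B f ->
  ae_period L (fun x => `|f x - trig_sum L f n x| <= tail_cst B / n.+1%:R).
Proof.
move=> fi hB; have gi := fourier_sum_intble hB.
have : ae_period L (fun x => f x - fourier_sum f x = 0).
  apply: fourier_unique => //; first exact: intbleB.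
  move=> m; have [c s] := fourier_sum_coef m hB.
  by rewrite coscoefB// sincoefB// c s !subrr.
apply: ae_period_imp => x /subr0_eq ->; exact: fourier_sum_approx.
Qed.

Lemma ae_bounded_of_decay B f : intble L f -> coef_decay B f ->
  ae_period L (fun x => `|f x| <= tail_cst B).
Proof.
move=> fi hB; apply: ae_period_imp (ae_trig_sum_approx 0 fi hB) => x.
by rewrite /trig_sum big_ord0 subr0 divr1.
Qed.

(** Parseval's inequality in the direction that needs completeness. *)
Lemma integ_sqr_le_of_modal_energy B f (X : R) :
  square_intble L f -> coef_decay B f ->
  (forall n, modal_energy L f n <= X) -> integ L (fun x => f x ^+ 2) <= X.
Proof.
move=> hf hB hX; have T0 := tail_cst_ge0 hB.
apply: (@le_of_le_addr_harmonic _ _ _ (tail_cst B ^+ 2 * L)).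
  by rewrite mulr_ge0 ?sqr_ge0// ltW.
move=> n; have := integ_sqr_le_modal_energy L_gt0 hf
  (ae_trig_sum_approx n (square_intble_intble hf) hB).
move=> /le_trans; apply; apply: lerD; first exact: hX.
rewrite [leRHS]mulrAC; apply: ler_wpM2r; first exact: ltW.
rewrite exprMn ler_wpM2l ?sqr_ge0//.
by rewrite expr2 ger_pMr ?invr_gt0// invf_le1// ler1n.
Qed.

(** [g] has the Fourier coefficients of the derivative of [f]. *)
Definition modal_deriv f g : Prop := forall n,
  coscoef L g n = wavenum L n * sincoef L f n /\
  sincoef L g n = - (wavenum L n * coscoef L f n).

Lemma is_derive_trig_sum f g n : modal_deriv f g ->
  forall x : R, is_derive x 1 (trig_sum L f n) (trig_sum L g n x).
Proof.
move=> hfg; elim: n => [|n IH] x.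
  have -> : trig_sum L f 0 = fun=> 0 by apply/funext => y; rewrite /trig_sum big_ord0.
  rewrite {1}/trig_sum big_ord0; exact: is_derive_cst.
have -> : trig_sum L f n.+1 = (fun y => trig_sum L f n y + modeweight L n *
    (coscoef L f n * cosm L n y + sincoef L f n * sinm L n y)).
  by apply/funext => y; rewrite /trig_sum big_ord_recr.
have dc := is_derive_cosm L n x; have ds := is_derive_sinm L n x.
have h := IH x.
apply: is_derive_eq; rewrite [RHS]/trig_sum big_ord_recr/= -/(trig_sum L g n x).
have [-> ->] := hfg n; rewrite /GRing.scale /=. ring.
Qed.

End Decay.

(** * The product rule for periodic weak derivatives *)

Section ProductRule.
Context (R : realType) (L : R).
Implicit Types (f g : R -> R) (n m : nat).
Hypothesis L_gt0 : 0 < L.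

Lemma cosm_end (k : int) : cosm L k L = cosm L k 0.
Proof. by have := cosm_periodic L_gt0 k 0; rewrite add0r. Qed.

Lemma sinm_end (k : int) : sinm L k L = sinm L k 0.
Proof. by have := sinm_periodic L_gt0 k 0; rewrite add0r. Qed.

(** Weak form of [f * g = (f ^ 2 / 2)'] when [g] is the derivative of [f], tested
    against [e]. For partial sums it is an integration by parts; the partial sums
    of [f] and [g] converge uniformly and boundedly, so it passes to the limit. *)
Lemma integ_test_mul_deriv (e e' f g : R -> R) (B B' M : R) :
  continuous e' -> (forall x : R, is_derive x 1 e (e' x)) -> e L = e 0 ->
  (forall x, `|e x| <= 1) -> (forall x, `|e' x| <= M) ->
  square_intble L f -> square_intble L g ->
  coef_decay L B f -> coef_decay L B' g -> modal_deriv L f g ->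
  integ L (fun x => e x * (f x * g x)) = - (2^-1 * integ L (fun x => e' x * f x ^+ 2)).
Proof.
move=> ce' de eL e1 e'M hf hg hB hB' hfg.
have ce : continuous e.
  by move=> x; apply/differentiable_continuous/derivable1_diffP; case: (de x).
have fi := square_intble_intble hf; have gi := square_intble_intble hg.
have fgi := square_intbleM hf hg; have [_ ffi] := hf.
have T0 := tail_cst_ge0 L_gt0 hB; have T0' := tail_cst_ge0 L_gt0 hB'.
set D := tail_cst L B in T0; set D' := tail_cst L B' in T0'.
have M0 : 0 <= M by apply: le_trans (e'M 0).
have i1 : intble L (fun x => e x * (f x * g x)).
  by apply: (intble_boundedM _ fgi (fun x _ => e1 x)); exact: continuous_meas.
have i2 : intble L (fun x => e' x * f x ^+ 2).
  by apply: (intble_boundedM _ ffi (fun x _ => e'M x)); exact: continuous_meas.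
apply/eqP; rewrite -subr_eq0 opprK; apply/eqP.
apply: (@eq0_of_le_harmonic _ _ ((2 * D * D' + M * D ^+ 2) * L)) => n.
pose S := trig_sum L f n; pose S' := trig_sum L g n.
have cS : continuous S by exact: continuous_trig_sum.
have cS' : continuous S' by exact: continuous_trig_sum.
pose G x := 2^-1 * (e' x * (S x * S x)) + e x * (S x * S' x).
have cG : continuous G.
  apply: continuous_fctD; first by apply: continuous_fctZ; do 2?apply: continuous_fctM.
  by do 2?apply: continuous_fctM.
have G0 : integ L G = 0.
  have dS (x : R) : is_derive x 1 S (S' x) by exact: is_derive_trig_sum.
  have dF (x : R) : is_derive x 1 (fun x => 2^-1 * (e x * (S x * S x))) (G x).
    have h1 := dS x; have h2 := de x.
    by apply: is_derive_eq; rewrite /G /GRing.scale/=; lra.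
  rewrite (integ_derive L_gt0 cG dF) eL.
  have -> : S L = S 0; last by rewrite subrr.
  apply: eq_bigr => k _.
  by rewrite cosm_end sinm_end.
have iG : intble L G by exact: continuous_intble.
have i3 : intble L (fun x => 2^-1 * (e' x * f x ^+ 2)) by exact: intbleZ.
rewrite -[leLHS](_ : `|integ L (fun x => e x * (f x * g x) +
  2^-1 * (e' x * f x ^+ 2) - G x)| = _); last first.
  by rewrite (integB (intbleD i1 i3) iG) (integD i1 i3) integZ// G0 subr0.
have -> : (2 * D * D' + M * D ^+ 2) * L / n.+1%:R
    = (2 * D * D' + M * D ^+ 2) / n.+1%:R * L by rewrite mulrAC.
apply: ae_period_integ_norm => //; first by apply: intbleB => //; exact: intbleD.
have a1 := ae_bounded_of_decay L_gt0 fi hB.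
have a2 := ae_bounded_of_decay L_gt0 gi hB'.
have a3 := ae_trig_sum_approx L_gt0 n fi hB.
have a4 := ae_trig_sum_approx L_gt0 n gi hB'.
apply: ae_period_imp (ae_period_and (ae_period_and a1 a2) (ae_period_and a3 a4)) => x.
rewrite -/D -/D' -/(S x) -/(S' x) => -[[fD gD'] [fS gS']].
have SD : `|S x| <= D by exact: trig_sum_bounded.
have SD' : `|S' x| <= D' by exact: trig_sum_bounded.
set h := n.+1%:R^-1; have h0 : 0 <= h by rewrite /h invr_ge0.
have -> : e x * (f x * g x) + 2^-1 * (e' x * f x ^+ 2) - G x =
    e x * (f x * (g x - S' x) + (f x - S x) * S' x) +
    2^-1 * (e' x * ((f x - S x) * (f x + S x))) by rewrite /G; ring.
apply: le_trans (ler_normD _ _) _.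
have b1 : `|f x * (g x - S' x) + (f x - S x) * S' x| <= 2 * D * D' * h.
  apply: le_trans (ler_normD _ _) _; rewrite !normrM.
  have := ler_pM (normr_ge0 _) (normr_ge0 _) fD gS'.
  have := ler_pM (normr_ge0 _) (normr_ge0 _) fS SD'.
  by rewrite -/h; lra.
have b2 : `|(f x - S x) * (f x + S x)| <= 2 * D ^+ 2 * h.
  rewrite normrM; have s : `|f x + S x| <= D + D.
    by apply: le_trans (ler_normD _ _) _; exact: lerD.
  have := ler_pM (normr_ge0 _) (normr_ge0 _) fS s.
  by rewrite -/h; lra.
rewrite [leRHS]mulrDl; apply: lerD.
  rewrite normrM -[leRHS]mul1r; exact: ler_pM.
rewrite normrM ger0_norm// normrM.
have := ler_pM (normr_ge0 _) (normr_ge0 _) (e'M x) b2.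
by lra.
Qed.

Lemma coscoef_mul_deriv (f g : R -> R) (B B' : R) n :
  square_intble L f -> square_intble L g ->
  coef_decay L B f -> coef_decay L B' g -> modal_deriv L f g ->
  coscoef L (fun x => f x * g x) n
    = 2^-1 * wavenum L n * sincoef L (fun x => f x ^+ 2) n /\
  sincoef L (fun x => f x * g x) n
    = - (2^-1 * wavenum L n * coscoef L (fun x => f x ^+ 2) n).
Proof.
move=> hf hg hB hB' hfg; have [_ ffi] := hf.
have cb (x : R) : `|- (wavenum L n * sinm L n x)| <= `|wavenum L n|.
  by rewrite normrN normrM ler_piMr// sinm_norm.
have sb (x : R) : `|wavenum L n * cosm L n x| <= `|wavenum L n|.
  by rewrite normrM ler_piMr// cosm_norm.
have cc : continuous (fun x => - (wavenum L n * sinm L n x)).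
  exact/continuous_fctN/continuous_fctZ/continuous_sinm.
have cs : continuous (fun x => wavenum L n * cosm L n x).
  exact/continuous_fctZ/continuous_cosm.
have := integ_test_mul_deriv cc (is_derive_cosm L n) (cosm_end n)
  (cosm_norm L n) cb hf hg hB hB' hfg.
have := integ_test_mul_deriv cs (is_derive_sinm L n) (sinm_end n)
  (sinm_norm L n) sb hf hg hB hB' hfg.
rewrite /coscoef /sincoef => -> ->; split.
- rewrite (_ : (fun x => - _ * _) =
    (fun x => - (wavenum L n * (sinm L n x * f x ^+ 2)))); last first.
    by apply/funext => x; ring.
  rewrite integN; last by apply: intbleZ; exact: intble_sinmM.
  by rewrite integZ; [ring | exact: intble_sinmM].
- rewrite (_ : (fun x => _ * _ * _) =
    (fun x => wavenum L n * (cosm L n x * f x ^+ 2))); last first.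
    by apply/funext => x; ring.
  by rewrite integZ; [ring | exact: intble_cosmM].
Qed.

End ProductRule.

(** * The Sobolev norms and the Fourier modes *)

Section SobolevNorm.
Context (R : realType) (L : R).
Implicit Types (f g u : R -> R) (n m s : nat).
Hypothesis L_gt0 : 0 < L.

Let sobolev_term s u (k : int) : R := (1 + k%:~R ^+ 2) ^+ s *
  (complex.Re (fourier_coef L u k) ^+ 2 + complex.Im (fourier_coef L u k) ^+ 2).

Lemma sobolev_termE s u (k : int) : sobolev_term s u k =
  L^-1 ^+ 2 * ((1 + k%:~R ^+ 2) ^+ s * (coscoef L u k ^+ 2 + sincoef L u k ^+ 2)).
Proof.
rewrite /sobolev_term /fourier_coef /= -[Rintegral _ _ _]/(coscoef L u k).
by rewrite -[X in - (_ * X)]/(sincoef L u k); ring.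
Qed.

Lemma sobolev_term_ge0 s u k : 0 <= sobolev_term s u k.
Proof.
rewrite sobolev_termE mulr_ge0 ?sqr_ge0// mulr_ge0 ?exprn_ge0//.
  by rewrite addr_ge0// sqr_ge0.
by rewrite addr_ge0 ?sqr_ge0.
Qed.

(** A single term of the series that defines the norm. *)
Lemma Hnorm_mode s u (x : R) n : (Hnorm s L u <= x%:E)%E ->
  (1 + n%:R ^+ 2) ^+ s * (coscoef L u n ^+ 2 + sincoef L u n ^+ 2) <= L * x ^+ 2.
Proof.
have L0 := ltW L_gt0; rewrite /Hnorm; set E := esum _ _ => Hx.
have tE : ((sobolev_term s u n)%:E <= E)%E.
  by apply: esum_ge; exists [set Posz n]; rewrite ?fsbig_set1//; split.
have t0 := sobolev_term_ge0 s u n.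
have Lt0 : 0 <= L * sobolev_term s u n by exact: mulr_ge0.
have LtE : ((L * sobolev_term s u n)%:E <= L%:E * E)%E.
  by rewrite EFinM lee_wpmul2l.
have h : ((L * sobolev_term s u n)%:E `^ 2^-1 <= x%:E)%E.
  apply: le_trans Hx; apply: gt0_ler_poweR => //.
  - by rewrite in_itv/= leey andbT lee_fin.
  - by rewrite in_itv/= leey andbT (le_trans _ LtE)// lee_fin.
move: h; rewrite poweR_EFin lee_fin powR12_sqrt// => h.
have x0 : 0 <= x by apply: le_trans h; exact: sqrtr_ge0.
have : Num.sqrt (L * sobolev_term s u n) ^+ 2 <= x ^+ 2.
  by rewrite lerXn2r ?nnegrE// sqrtr_ge0.
rewrite sqr_sqrtr// sobolev_termE mulrA.
have -> : L * L^-1 ^+ 2 = L^-1 by field; rewrite gt_eqF.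
by rewrite ler_pdivrMl// -pmulrn.
Qed.

(** The modes [k] and [- k] of a real function have the same modulus; adding
    them turns the sum over the integers into one over the naturals, with the
    weights [modeweight]. *)
Lemma Hnorm_le s u (M : R) : intble L u -> 0 <= M ->
  (forall N, \sum_(n < N) modeweight L n * ((1 + n%:R ^+ 2) ^+ s *
     (coscoef L u n ^+ 2 + sincoef L u n ^+ 2)) <= M) ->
  (Hnorm s L u <= (Num.sqrt M)%:E)%E.
Proof.
move=> ui M0 hM; have L0 := ltW L_gt0; rewrite /Hnorm.
rewrite (eq_esum (b := fun k : int => (sobolev_term s u k)%:E))//.
pose b n : R := sobolev_term s u n.
have b0 n : 0 <= b n by exact: sobolev_term_ge0.
have bN n : sobolev_term s u (Negz n) = b n.+1.
  rewrite /b !sobolev_termE NegzE rmorphN/= sqrrN.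
  rewrite -[in LHS](_ : coscoef L u n.+1 = coscoef L u (- n.+1%:Z)); last first.
    by rewrite /coscoef; under [in RHS]eq_fun do rewrite cosmN.
  suff -> : sincoef L u (- n.+1%:Z) = - sincoef L u n.+1 by rewrite sqrrN.
  rewrite /sincoef; under eq_fun do rewrite sinmN mulNr.
  by rewrite integN//; exact: intble_sinmM.
have -> : (\esum_(k in [set: int]) (sobolev_term s u k)%:E =
   \sum_(0 <= n <oo) ((b n)%:E + (b n.+1)%:E))%E.
  rewrite nneseriesD//; try by move=> i _ _; rewrite lee_fin.
  rewrite (esumID [set k : int | 0 <= k])//; last by move=> i _; rewrite lee_fin sobolev_term_ge0.
  rewrite !setTI; congr (_ + _)%E.
    rewrite nneseries_esumT; last by move=> n; rewrite lee_fin.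
    apply: reindex_esum; split => //.
    - by move=> n m _ _ [].
    - by move=> [n|n]//= _; exists n.
  rewrite nneseries_esumT; last by move=> n; rewrite lee_fin.
  rewrite [RHS](eq_esum (b := fun n => (sobolev_term s u (Negz n))%:E)); last first.
    by move=> n _; rewrite bN.
  apply: (@reindex_esum _ _ _ _ _ Negz); split => //.
  - by move=> n m _ _ [].
  - by move=> [n|n]//= _; exists n.
set E := (\sum_(0 <= _ <oo) _)%E.
have E0 : (0 <= E)%E by apply: nneseries_ge0 => n _ _; rewrite lee_fin addr_ge0.
have EM : (L%:E * E <= M%:E)%E.
  rewrite -nneseriesZl; last by move=> n _; rewrite lee_fin addr_ge0.
  apply: lime_le.
    by apply: is_cvg_nneseries => n _ _; rewrite mule_ge0 ?lee_fin ?addr_ge0.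
  apply: nearW => N; under eq_bigr do rewrite -EFinD -EFinM.
  rewrite sumEFin lee_fin big_mkord.
  apply: le_trans (hM N.+1).
  have -> : forall N, \sum_(i < N) L * (b i + b i.+1) =
     \sum_(i < N.+1) modeweight L i * ((1 + i%:R ^+ 2) ^+ s *
     (coscoef L u i ^+ 2 + sincoef L u i ^+ 2)) - L * b N.
    elim=> [|k IH].
      by rewrite big_ord0 big_ord_recr big_ord0/= /b sobolev_termE -pmulrn; field; rewrite gt_eqF.
    rewrite big_ord_recr IH [in RHS]big_ord_recr/= /b !sobolev_termE -!pmulrn/=.
    by field; rewrite gt_eqF.
  by rewrite gerBl mulr_ge0.
rewrite -powR12_sqrt// -poweR_EFin.
apply: gt0_ler_poweR => //; rewrite in_itv/= leey andbT ?lee_fin//.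
by rewrite mule_ge0.
Qed.

End SobolevNorm.

(** * Functions with a finite third Sobolev norm *)

Section SobolevConsequences.
Context (R : realType) (L : R).
Implicit Types (f g u : R -> R) (n m s : nat).
Hypothesis L_gt0 : 0 < L.

Lemma wavenum_nat n : wavenum L n = wavenum L 1 * n%:R.
Proof. by rewrite /wavenum mulr1 -pmulrn. Qed.

Lemma decay_of_Hnorm3 u (x : R) : 0 <= x -> (Hnorm 3 L u <= x%:E)%E ->
  coef_decay L (Num.sqrt L * x) u.
Proof.
move=> x0 hu; have L0 := ltW L_gt0; split; first by rewrite mulr_ge0 ?sqrtr_ge0.
move=> n; have := Hnorm_mode L_gt0 n hu; set E := _ + sincoef _ _ _ ^+ 2.
have y1 : 1 <= 1 + n%:R ^+ 2 :> R by rewrite lerDl sqr_ge0.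
set y := 1 + n%:R ^+ 2 in y1 *.
have y0 : 0 < y by lra.
have E0 : 0 <= E by rewrite addr_ge0 ?sqr_ge0.
rewrite !exprMn sqr_sqrtr// exprVn => h.
rewrite ler_pdivlMr ?exprn_gt0//; apply: le_trans h; rewrite mulrC.
by rewrite ler_wpM2r// ler_weXn2l.
Qed.

Lemma decay_deriv_of_Hnorm3 f g (x : R) : 0 <= x -> (Hnorm 3 L f <= x%:E)%E ->
  modal_deriv L f g -> coef_decay L (wavenum L 1 * (Num.sqrt L * x)) g.
Proof.
move=> x0 hu hfg; have L0 := ltW L_gt0; have k0 := wavenum1_gt0 L_gt0.
split; first by apply: mulr_ge0; [exact: ltW | rewrite mulr_ge0 ?sqrtr_ge0].
move=> n; have [-> ->] := hfg n.
have := Hnorm_mode L_gt0 n hu.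
set c := coscoef _ _ _; set d := sincoef _ _ _; rewrite wavenum_nat.
set k := wavenum L 1 in k0 *; clearbody k.
set y := 1 + n%:R ^+ 2.
have y0 : 0 < y by rewrite /y ltr_pwDl ?sqr_ge0.
have -> : (k * n%:R * d) ^+ 2 + (- (k * n%:R * c)) ^+ 2 =
  k ^+ 2 * (n%:R ^+ 2 * (c ^+ 2 + d ^+ 2)) by ring.
rewrite !exprMn sqr_sqrtr// exprVn -mulrA => h.
apply: ler_wpM2l; first exact: sqr_ge0.
rewrite ler_pdivlMr ?exprn_gt0//; apply: le_trans h.
have -> : y ^+ 3 * (c ^+ 2 + d ^+ 2) = y * (c ^+ 2 + d ^+ 2) * y ^+ 2 by ring.
rewrite ler_wpM2r ?sqr_ge0// ler_wpM2r ?addr_ge0 ?sqr_ge0//.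
by rewrite /y lerDr.
Qed.

Lemma ae_bounded_of_Hnorm3 u (x : R) : intble L u -> 0 <= x ->
  (Hnorm 3 L u <= x%:E)%E ->
  ae_period L (fun y => `|u y| <= 16 / Num.sqrt L * x).
Proof.
move=> ui x0 hu; have := ae_bounded_of_decay L_gt0 ui (decay_of_Hnorm3 x0 hu).
congr ae_period; apply/funext => y; congr (_ <= _).
have s0 : 0 < Num.sqrt L by rewrite sqrtr_gt0.
have e : L = Num.sqrt L * Num.sqrt L by rewrite -expr2 sqr_sqrtr// ltW.
rewrite /tail_cst; move: e s0; set q := Num.sqrt L => e s0.
have -> : 16 * (q * x) / L = 16 * (q * x) / (q * q) by rewrite -e.
by field; rewrite gt_eqF.
Qed.

Lemma L2per_square_intble u : L2per L u -> square_intble L u.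
Proof. by move=> [_ mu ui]; split => //; exact: measurable_funTS. Qed.

Lemma fourier_coefE u (k : int) : fourier_coef L u k =
  Complex (L^-1 * coscoef L u k) (- (L^-1 * sincoef L u k)).
Proof. by []. Qed.

Lemma modal_deriv_of_weak f f1 f2 f3 :
  weak_deriv L 1 f f1 -> weak_deriv L 2 f f2 -> weak_deriv L 3 f f3 ->
  [/\ modal_deriv L f f1, modal_deriv L f1 f2 & modal_deriv L f2 f3].
Proof.
have Lu : L^-1 != 0 by rewrite invr_eq0 gt_eqF.
have step (g h : R -> R) n : fourier_coef L h n =
    Complex 0 (wavenum L n) * fourier_coef L g n ->
    coscoef L h n = wavenum L n * sincoef L g n /\
    sincoef L h n = - (wavenum L n * coscoef L g n).
  rewrite !fourier_coefE => -[h1 h2].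
  split; apply: (mulfI Lu).
    by rewrite [LHS]h1 /=; ring.
  by apply: oppr_inj; rewrite [LHS]h2 /=; ring.
move=> [_ _ h1] [_ _ h2] [_ _ h3]; split => n; apply: step.
- by rewrite h1 expr1.
- by rewrite h2 h1 mulrA -/(wavenum L n) -exprS.
- by rewrite h3 h2 mulrA -/(wavenum L n) -exprS.
Qed.

Lemma modal_deriv_of_derive (p q : R -> R) : continuous q ->
  (forall x : R, is_derive x 1 p (q x)) -> p L = p 0 -> modal_deriv L p q.
Proof.
move=> cq dp pL n.
have cp : continuous p.
  by move=> x; apply/differentiable_continuous/derivable1_diffP; case: (dp x).
have pi : intble L p by exact: continuous_intble.
have qi : intble L q by exact: continuous_intble.
split.
- have dF (x : R) : is_derive x 1 (fun x => cosm L n x * p x)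
     (cosm L n x * q x - wavenum L n * (sinm L n x * p x)).
    have h1 := dp x; have h2 := is_derive_cosm L n x.
    by apply: is_derive_eq; rewrite /GRing.scale/=; ring.
  have := integ_derive L_gt0 _ dF.
  rewrite cosm_end// pL subrr integB ?integZ;
    try by [exact: intble_cosmM|exact: intble_sinmM|apply: intbleZ; exact: intble_sinmM].
  move=> h; apply/eqP; rewrite -subr_eq0; apply/eqP; apply: h.
  apply: continuous_fctD; first by apply: continuous_fctM => //; exact: continuous_cosm.
  apply/continuous_fctN/continuous_fctZ.
  by apply: continuous_fctM => //; exact: continuous_sinm.
- have dF (x : R) : is_derive x 1 (fun x => sinm L n x * p x)
     (sinm L n x * q x + wavenum L n * (cosm L n x * p x)).
    have h1 := dp x; have h2 := is_derive_sinm L n x.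
    by apply: is_derive_eq; rewrite /GRing.scale/=; ring.
  have := integ_derive L_gt0 _ dF.
  rewrite sinm_end// pL subrr integD ?integZ;
    try by [exact: intble_cosmM|exact: intble_sinmM|apply: intbleZ; exact: intble_cosmM].
  move=> h; apply/eqP; rewrite -addr_eq0; apply/eqP; apply: h.
  apply: continuous_fctD; first by apply: continuous_fctM => //; exact: continuous_sinm.
  apply/continuous_fctZ.
  by apply: continuous_fctM => //; exact: continuous_cosm.
Qed.

(** Since [(1 + n ^ 2) ^ 3 <= 4 * (1 + n ^ 6)], Bessel's inequality for [p] and
    for its third derivative bounds the norm. *)
Lemma continuous_Hper3 (p p1 p2 p3 : R -> R) :
  periodic p L -> continuous p -> continuous p3 ->
  modal_deriv L p p1 -> modal_deriv L p1 p2 -> modal_deriv L p2 p3 -> Hper 3 L p.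
Proof.
move=> pp cp cp3 h1 h2 h3.
have sp := continuous_square_intble L cp; have sp3 := continuous_square_intble L cp3.
split; first by split => //; [exact: continuous_measurable_fun | case: sp].
have k0 := wavenum1_gt0 L_gt0.
pose M := 4 * integ L (fun x => p x ^+ 2) +
   4 / wavenum L 1 ^+ 6 * integ L (fun x => p3 x ^+ 2).
have M0 : 0 <= M.
  by rewrite addr_ge0// mulr_ge0 ?divr_ge0 ?exprn_ge0 ?(ltW k0)//;
     apply: Rintegral_ge0 => x _; exact: sqr_ge0.
apply: (@le_lt_trans _ _ (Num.sqrt M)%:E); last by rewrite ltry.
apply: Hnorm_le => //; first exact: square_intble_intble.
move=> N; have b1 := bessel L_gt0 N sp; have b2 := bessel L_gt0 N sp3.
rewrite /M; set k := wavenum L 1 in k0 *.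
have kn n : wavenum L n = k * n%:R by exact: wavenum_nat.
move: k k0 kn {M M0} => k k0 kn.
have k6 : 0 < 4 / k ^+ 6 by rewrite divr_gt0// exprn_gt0.
apply: (@le_trans _ _ (4 * modal_energy L p N + 4 / k ^+ 6 * modal_energy L p3 N)).
  rewrite /modal_energy !mulr_sumr -big_split/=; apply: ler_sum => n _.
  rewrite [4 * (_ * _)]mulrCA [4 / _ * (_ * _)]mulrCA -mulrDr ler_wpM2l ?(ltW (modeweight_gt0 _ _))//.
  have [-> ->] := h3 n; have [-> ->] := h2 n; have [-> ->] := h1 n.
  rewrite kn; set c := coscoef _ _ _; set d := sincoef _ _ _.
  set y : R := n%:R.
  have -> : (k * y * - (k * y * (k * y * d))) ^+ 2 +
    (- (k * y * (k * y * - (k * y * c)))) ^+ 2 = k ^+ 6 * (y ^+ 2) ^+ 3 * (c ^+ 2 + d ^+ 2) by ring.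
  have -> : 4 * (c ^+ 2 + d ^+ 2) + 4 / k ^+ 6 * (k ^+ 6 * (y ^+ 2) ^+ 3 * (c ^+ 2 + d ^+ 2))
    = 4 * (1 + (y ^+ 2) ^+ 3) * (c ^+ 2 + d ^+ 2) by field; rewrite gt_eqF.
  rewrite ler_wpM2r ?addr_ge0 ?sqr_ge0//.
  have := sqr_ge0 y; set z := y ^+ 2 => z0.
  have z1 : 0 <= z + 1 by lra.
  have := mulr_ge0 z1 (sqr_ge0 (z - 1)).
  by rewrite !exprS expr0 !mulr1; nra.
by apply: lerD; rewrite ler_wpM2l// ltW.
Qed.

(** * The Fourier modes of the right-hand side *)

Definition kdvbf_rhs (r alpha : R) (v vx vxx vxxx : R -> R) (x : R) : R :=
  vxx x + r * v x * (1 - v x) - alpha * v x * vx x - vxxx x.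

(** The velocities of the two real coefficients of the n-th mode under the
    flow. The transport term is a derivative of [v ^ 2], so that both velocities
    depend on [v] and [v ^ 2] only. *)
Definition cos_rate (r alpha : R) (v : R -> R) n : R :=
  (r - wavenum L n ^+ 2) * coscoef L v n + wavenum L n ^+ 3 * sincoef L v n
  - r * coscoef L (fun x => v x ^+ 2) n
  - alpha / 2 * wavenum L n * sincoef L (fun x => v x ^+ 2) n.

Definition sin_rate (r alpha : R) (v : R -> R) n : R :=
  (r - wavenum L n ^+ 2) * sincoef L v n - wavenum L n ^+ 3 * coscoef L v n
  - r * sincoef L (fun x => v x ^+ 2) n
  + alpha / 2 * wavenum L n * coscoef L (fun x => v x ^+ 2) n.

Lemma kdvbf_rhs_intble r alpha v vx vxx vxxx :
  square_intble L v -> square_intble L vx -> intble L vxx -> intble L vxxx ->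
  intble L (kdvbf_rhs r alpha v vx vxx vxxx).
Proof.
move=> sv svx ixx ixxx.
have iv := square_intble_intble sv; have iv2 : intble L (fun x => v x ^+ 2) by case: sv.
have ivx := square_intbleM sv svx.
have := intbleB (intbleB (intbleD ixx (intbleB (intbleZ r iv) (intbleZ r iv2)))
  (intbleZ alpha ivx)) ixxx.
by congr intble; apply/funext => x; rewrite /kdvbf_rhs; ring.
Qed.

Lemma kdvbf_rhs_coef r alpha v vx vxx vxxx B B' n :
  square_intble L v -> square_intble L vx -> intble L vxx -> intble L vxxx ->
  coef_decay L B v -> coef_decay L B' vx ->
  modal_deriv L v vx -> modal_deriv L vx vxx -> modal_deriv L vxx vxxx ->
  coscoef L (kdvbf_rhs r alpha v vx vxx vxxx) n = cos_rate r alpha v n /\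
  sincoef L (kdvbf_rhs r alpha v vx vxx vxxx) n = sin_rate r alpha v n.
Proof.
move=> sv svx ixx ixxx dv dvx h1 h2 h3.
have iv := square_intble_intble sv; have iv2 : intble L (fun x => v x ^+ 2) by case: sv.
have ivx := square_intbleM sv svx.
have -> : kdvbf_rhs r alpha v vx vxx vxxx = (fun x =>
    vxx x + (r * v x - r * v x ^+ 2) - alpha * (v x * vx x) - vxxx x).
  by apply/funext => x; rewrite /kdvbf_rhs; ring.
have i1 := intbleB (intbleZ r iv) (intbleZ r iv2).
have i2 := intbleD ixx i1.
have i3 := intbleB i2 (intbleZ alpha ivx).
have [p1 p2] := coscoef_mul_deriv L_gt0 n sv svx dv dvx h1.
have [x1 x2] := h1 n; have [y1 y2] := h2 n; have [z1 z2] := h3 n.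
rewrite (coscoefB _ i3 ixxx) (sincoefB _ i3 ixxx).
rewrite (coscoefB _ i2 (intbleZ alpha ivx)) (sincoefB _ i2 (intbleZ alpha ivx)).
rewrite (coscoefD _ ixx i1) (sincoefD _ ixx i1).
rewrite (coscoefB _ (intbleZ r iv) (intbleZ r iv2)).
rewrite (sincoefB _ (intbleZ r iv) (intbleZ r iv2)).
rewrite !coscoefZ// !sincoefZ// p1 p2 z1 z2 y1 y2 x1 x2.
by rewrite /cos_rate /sin_rate; split; field.
Qed.

End SobolevConsequences.

(** * Solutions as trajectories of Fourier modes *)

Section ModalSolution.
Context (R : realType) (r alpha L : R).
Implicit Types (f g : R -> R) (u v : R -> R -> R) (n m : nat).
Hypothesis L_gt0 : 0 < L.

(** Each Fourier mode obeys its ordinary differential equation. This is all that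
    the energy estimate uses, and it is shared by strong solutions, for which the
    time derivative exists in [L^2] only, and by the smooth traveling waves. *)
Definition modal_solution v : Prop :=
  [/\ forall t, 0 <= t -> square_intble L (v t),
      forall t, 0 <= t -> exists2 x : R, 0 <= x & (Hnorm 3 L (v t) <= x%:E)%E,
      forall n (t : R), 0 < t ->
        is_derive t 1 (fun s => coscoef L (v s) n) (cos_rate L r alpha (v t) n) /\
        is_derive t 1 (fun s => sincoef L (v s) n) (sin_rate L r alpha (v t) n) &
      forall n,
        coscoef L (v s) n @[s --> 0^'+] --> coscoef L (v 0) n /\
        sincoef L (v s) n @[s --> 0^'+] --> sincoef L (v 0) n].

Lemma is_derive_of_cvg (f : R -> R) (t a : R) :
  (f (t + h) - f t) / h @[h --> 0^'] --> a -> is_derive t 1 f a.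
Proof.
move=> fa.
have fa' : h^-1 *: (f (h *: 1 + t) - f t) @[h --> 0^'] --> a.
  by move: fa; apply: cvg_trans; apply: near_eq_cvg; near=> h;
     rewrite /GRing.scale/= mulr1 [h + t]addrC mulrC.
apply: DeriveDef; first by apply/cvg_ex; exists a.
by apply/cvg_lim.
Unshelve. all: by end_near. Qed.

(** Convergence to zero in [L^2] forces convergence of each mode. *)
Lemma Hnorm0_cvg_mode (F : set_system R) (FF : Filter F) (D : R -> R -> R) n :
  Hnorm 0 L (D h) @[h --> F] --> 0%E ->
  coscoef L (D h) n @[h --> F] --> (0 : R) /\
  sincoef L (D h) n @[h --> F] --> (0 : R).
Proof.
move=> hD.
have key (e : R) : 0 < e -> \forall h \near F,
    coscoef L (D h) n ^+ 2 + sincoef L (D h) n ^+ 2 <= e ^+ 2.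
  move=> e0; have s0 : 0 < Num.sqrt L by rewrite sqrtr_gt0.
  have d0 : 0 < e / Num.sqrt L by rewrite divr_gt0.
  have : \forall h \near F, (Hnorm 0 L (D h) < (e / Num.sqrt L)%:E)%E.
    apply: (hD [set y : \bar R | (y < (e / Num.sqrt L)%:E)%E]).
    apply: open_nbhs_nbhs.
    by split; [exact: open_ereal_lt_ereal | rewrite /= lte_fin].
  apply: filterS => h /ltW /(Hnorm_mode L_gt0 n).
  rewrite expr0 mul1r exprMn exprVn sqr_sqrtr ?(ltW L_gt0)// => /le_trans; apply.
  by rewrite mulrCA divff ?mulr1// gt_eqF.
split; apply/cvgr0Pnorm_le => e e0; have := key e e0; apply: filterS => h hh.
- rewrite -(ler_pXn2r (n := 2)) ?nnegrE ?(ltW e0)// real_normK ?num_real//.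
  by apply: le_trans hh; rewrite lerDl sqr_ge0.
- rewrite -(ler_pXn2r (n := 2)) ?nnegrE ?(ltW e0)// real_normK ?num_real//.
  by apply: le_trans hh; rewrite lerDr sqr_ge0.
Qed.

Lemma global_solution_modal u : global_solution r alpha L u -> modal_solution u.
Proof.
move=> [uH _ ut].
have su t : 0 <= t -> square_intble L (u t).
  by move=> /uH[/L2per_square_intble].
have fu t : 0 <= t -> exists2 x : R, 0 <= x & (Hnorm 3 L (u t) <= x%:E)%E.
  move=> /uH[_ fin].
  have n0 : (0 <= Hnorm 3 L (u t))%E by exact: poweR_ge0.
  exists (fine (Hnorm 3 L (u t))); first exact: fine_ge0.
  by rewrite fineK// ge0_fin_numE.
have dq t n : 0 <= t ->
   (coscoef L (u (t + h)) n - coscoef L (u t) n) / h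
      @[h --> within [set h | 0 <= t + h] 0^'] --> cos_rate L r alpha (u t) n /\
   (sincoef L (u (t + h)) n - sincoef L (u t) n) / h
      @[h --> within [set h | 0 <= t + h] 0^'] --> sin_rate L r alpha (u t) n.
  move=> t0; have [ux [uxx [uxxx [w1 w2 w3 hD]]]] := ut t t0.
  have [m1 m2 m3] := modal_deriv_of_weak L_gt0 w1 w2 w3.
  have [x x0 hx] := fu t t0.
  have sut := su t t0.
  have sux : square_intble L ux by case: w1 => _ /L2per_square_intble.
  have iuxx : intble L uxx by case: w2 => _ /L2per_square_intble /square_intble_intble.
  have iuxxx : intble L uxxx by case: w3 => _ /L2per_square_intble /square_intble_intble.
  have dv := decay_of_Hnorm3 L_gt0 x0 hx.
  have dvx := decay_deriv_of_Hnorm3 L_gt0 x0 hx m1.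
  have [e1 e2] := kdvbf_rhs_coef L_gt0 r alpha n sut sux iuxx iuxxx dv dvx m1 m2 m3.
  have irhs := kdvbf_rhs_intble r alpha sut sux iuxx iuxxx.
  have [c1 c2] := @Hnorm0_cvg_mode _ _ _ n hD.
  have iut := square_intble_intble sut.
  have it : \forall h \near within [set h | 0 <= t + h] (0 : R)^', 0 <= t + h.
    by apply: withinT.
  have modes h : 0 <= t + h ->
     coscoef L (fun x => (u (t + h) x - u t x) / h - kdvbf_rhs r alpha (u t) ux uxx uxxx x) n
     = (coscoef L (u (t + h)) n - coscoef L (u t) n) / h - cos_rate L r alpha (u t) n /\
     sincoef L (fun x => (u (t + h) x - u t x) / h - kdvbf_rhs r alpha (u t) ux uxx uxxx x) n
     = (sincoef L (u (t + h)) n - sincoef L (u t) n) / h - sin_rate L r alpha (u t) n.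
    move=> th; have iuh := square_intble_intble (su _ th).
    under eq_fun do rewrite mulrC.
    have ib := intbleB iuh iut; have ic := intbleZ h^-1 ib.
    rewrite (coscoefB _ ic irhs) (sincoefB _ ic irhs) coscoefZ// sincoefZ//.
    by rewrite (coscoefB _ iuh iut) (sincoefB _ iuh iut) e1 e2 ![_ / h]mulrC.
  split; apply/subr_cvg0.
  - move: c1; apply: cvg_trans; apply: near_eq_cvg.
    by move: it; apply: filterS => h /modes[].
  - move: c2; apply: cvg_trans; apply: near_eq_cvg.
    by move: it; apply: filterS => h /modes[].
split => //.
- move=> n t t0; have [d1 d2] := dq t n (ltW t0).
  have sub : within [set h | 0 <= t + h] (0 : R)^' `<=` (0 : R)^'.
    move=> A; rewrite /within/= => wA.
    have nt : \forall h \near (0 : R)^', 0 <= t + h.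
      move: (dnbhs0_lt (V := R) t0); apply: filterS => h.
      by rewrite ltr_norml => /andP[h1 _]; lra.
    by apply: filterS2 wA nt => h; apply.
  by split; apply: is_derive_of_cvg; [apply: cvg_trans d1|apply: cvg_trans d2];
    exact: cvg_app.
- move=> n; have [d1 d2] := dq 0 n (lexx 0).
  have sub : within [set h | 0 <= 0 + h] (0 : R)^' `<=` (0 : R)^'+.
    move=> A wA.
    have {}wA : \forall h \near (0 : R), h != 0 -> 0 <= 0 + h -> A h by exact: wA.
    have : \forall h \near (0 : R), 0 < h -> A h.
      move: wA; apply: filterS => h hA h0.
      by apply: hA; [rewrite gt_eqF | rewrite add0r ltW].
    by [].
  have key (C : R -> R) (a : R) :
      (C (0 + h) - C 0) / h @[h --> within [set h | 0 <= 0 + h] (0 : R)^'] --> a ->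
      C s @[s --> (0 : R)^'+] --> C 0.
    move=> /(cvg_trans (cvg_app _ sub)) c.
    have h0 : h @[h --> (0 : R)^'+] --> (0 : R) by apply: cvg_at_right_filter; exact: cvg_id.
    have : h * ((C (0 + h) - C 0) / h) + C 0 @[h --> (0 : R)^'+] --> 0 * a + C 0.
      by apply: cvgD; [exact: cvgM | exact: cvg_cst].
    rewrite mul0r add0r.
    apply: cvg_trans; apply: near_eq_cvg; near=> h.
    have hn0 : h != 0 by rewrite gt_eqF//; near: h; exact: nbhs_right_gt.
    by rewrite /= add0r mulrCA divff// mulr1 subrK.
  by split; [exact: key d1 | exact: key d2].
Unshelve. all: by end_near. Qed.

End ModalSolution.

(** * Traveling waves *)

Section Wave.
Context (R : realType) (r alpha c L : R) (phi : R -> R).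
Implicit Types (n j : nat).
Hypothesis wave : periodic_wave r alpha c L phi.

Let L_gt0 : 0 < L. Proof. by case: wave => _ []. Qed.

Lemma wave_is_derive j (x : R) : is_derive x 1 (derive1n j phi) (derive1n j.+1 phi x).
Proof.
case: wave => sm _ _; rewrite derive1nS derive1E.
by apply: DeriveDef => //; exact: sm.
Qed.

Lemma is_derive_translate j (a x : R) : is_derive x 1
  (fun y => derive1n j phi (y - a)) (derive1n j.+1 phi (x - a)).
Proof.
have h := wave_is_derive j (x - a).
have h2 : is_derive x 1 (fun y : R => y - a) 1.
  by apply: is_derive_eq; rewrite subr0.
by have := @is_derive1_comp R (derive1n j phi) (fun y => y - a) x _ _ h h2; rewrite mulr1.
Qed.

Lemma continuous_translate j (a : R) : continuous (fun y => derive1n j phi (y - a)).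
Proof.
move=> x; apply/differentiable_continuous/derivable1_diffP.
by case: (is_derive_translate j a x).
Qed.

Lemma wave_periodic j : periodic (derive1n j phi) L.
Proof.
elim: j => [|j IH] x; first by case: wave => _ [].
have [_] := is_derive_translate j (- L) x; rewrite opprK => <-.
have [_ <-] := wave_is_derive j x.
by congr ('D_1 _ x); apply/funext => y; rewrite -[RHS]IH.
Qed.

Lemma translate_periodic j a : periodic (fun y => derive1n j phi (y - a)) L.
Proof. by move=> x; rewrite addrAC wave_periodic. Qed.

Lemma translate_modal_deriv j (a : R) : modal_deriv L
  (fun y => derive1n j phi (y - a)) (fun y => derive1n j.+1 phi (y - a)).
Proof.
apply: modal_deriv_of_derive => //.
- exact: continuous_translate.
- exact: is_derive_translate.
- by have := translate_periodic j a 0; rewrite add0r.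
Qed.

Lemma translate_Hper (a d : R) : Hper 3 L (fun y => phi (y - a) + d).
Proof.
have pd : periodic (fun y => phi (y - a) + d) L.
  by move=> x; congr (_ + d); exact: (translate_periodic 0).
have cd : continuous (fun y => phi (y - a) + d).
  apply: continuous_fctD; first exact: (@continuous_translate 0).
  by move=> x; exact: cst_continuous.
apply: (continuous_Hper3 L_gt0 pd cd (@continuous_translate 3 a)
  _ (translate_modal_deriv 1 a) (translate_modal_deriv 2 a)).
apply: modal_deriv_of_derive => //.
- exact: continuous_translate.
- move=> x; have h := is_derive_translate 0 a x.
  by apply: is_derive_eq; rewrite addr0.
- by have := pd 0; rewrite add0r.
Qed.

(** The profile equation, with the time derivative expressed by the speed. *)
Lemma wave_profile (x : R) : - (c * derive1n 1 phi x) =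
  kdvbf_rhs r alpha phi (derive1n 1 phi) (derive1n 2 phi) (derive1n 3 phi) x.
Proof.
case: wave => _ _ /(_ 0 x).
have -> : (fun x0 => phi (x0 - c * 0)) = phi by apply/funext => y; rewrite mulr0 subr0.
have -> : derive1 (fun s => phi (x - c * s)) 0 = - (c * derive1n 1 phi x).
  have h2 : is_derive (0 : R) 1 (fun s : R => x - c * s) (- c).
    by apply: is_derive_eq; rewrite /GRing.scale/=; ring.
  have h := wave_is_derive 0 (x - c * 0).
  have [_ ] := @is_derive1_comp R phi (fun s => x - c * s) 0 _ _ h h2.
  rewrite derive1E => ->.
  by rewrite mulr0 subr0; ring.
rewrite mulr0 subr0 /kdvbf_rhs => h.
rewrite -[derive1n 1 phi x]/(derive1 phi x) in h *; lra.
Qed.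

(** The modes of the translated profile are differentiated under the integral;
    the profile equation then turns the time derivative into the right-hand
    side of the evolution equation. *)
Lemma wave_modal_solution : modal_solution r alpha L (fun t x => phi (x - c * t)).
Proof.
have L0 := L_gt0.
have sp j a : square_intble L (fun y => derive1n j phi (y - a)).
  by apply: continuous_square_intble; exact: continuous_translate.
have ip j a := square_intble_intble (sp j a).
have fin (a : R) : exists2 x : R, 0 <= x & (Hnorm 3 L (fun y => phi (y - a)) <= x%:E)%E.
  have [_] := translate_Hper a 0; under eq_fun do rewrite addr0.
  move=> fin; have n0 : (0 <= Hnorm 3 L (fun y => phi (y - a)))%E by exact: poweR_ge0.
  exists (fine (Hnorm 3 L (fun y => phi (y - a)))); first exact: fine_ge0.
  by rewrite fineK// ge0_fin_numE.
have rate (t : R) n : coscoef L (fun x => - (c * derive1n 1 phi (x - c * t))) n =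
      cos_rate L r alpha (fun x => phi (x - c * t)) n /\
    sincoef L (fun x => - (c * derive1n 1 phi (x - c * t))) n =
      sin_rate L r alpha (fun x => phi (x - c * t)) n.
  under eq_fun do rewrite wave_profile.
  have [x x0 hx] := fin (c * t).
  apply: (kdvbf_rhs_coef L0 r alpha n (sp 0 _) (sp 1 _) (ip 2 _) (ip 3 _)
    (decay_of_Hnorm3 L0 x0 hx)
    (decay_deriv_of_Hnorm3 L0 x0 hx (translate_modal_deriv 0 (c * t)))).
  - exact: (translate_modal_deriv 0).
  - exact: (translate_modal_deriv 1).
  - exact: (translate_modal_deriv 2).
have under_int (e : R -> R) (t : R) : continuous e -> (forall x, `|e x| <= 1) ->
    is_derive t 1 (fun s => integ L (fun x => e x * phi (x - c * s)))
      (integ L (fun x => e x * - (c * derive1n 1 phi (x - c * t)))).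
  move=> ce e1.
  pose f (s x : R) := e x * phi (x - c * s).
  have df (s x : R) : is_derive s 1 (f^~ x) (e x * - (c * derive1n 1 phi (x - c * s))).
    have h2 : is_derive s 1 (fun s : R => x - c * s) (- c).
      by apply: is_derive_eq; rewrite /GRing.scale/=; ring.
    have h : is_derive s 1 (fun s : R => phi (x - c * s)) _ :=
      @is_derive1_comp R phi (fun s => x - c * s) s _ _
      (wave_is_derive 0 (x - c * s)) h2.
    by apply: is_derive_eq; rewrite /GRing.scale/=; ring.
  (* For [x] in a period and times within 1 of [t], all points [x - c * s] lie in
     the interval between [- K] and [K]. *)
  pose K := L + `|c| * (`|t| + 1).
  have K0 : 0 <= K + K by rewrite /K; have := normr_ge0 c; have := normr_ge0 t; nra.
  have [M hM] := continuous_bounded K0 (@continuous_translate 1 K).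
  have M0 : 0 <= `|c| * M.
    rewrite mulr_ge0//; apply: le_trans (hM 0 _); first exact: normr_ge0.
    by rewrite in_itv/= lexx.
  have bd (s x : R) : s \in `]t - 1, t + 1[ -> x \in `[0, L] ->
      `|e x * - (c * derive1n 1 phi (x - c * s))| <= `|c| * M.
    rewrite !in_itv/= => st /andP[x0 xL].
    have hs : `|s| <= `|t| + 1.
      have : `|s - t| <= 1 by rewrite ler_norml; lra.
      by have := ler_normB s t; have := ler_normD (s - t) t; rewrite subrK; lra.
    have : `|c * s| <= `|c| * (`|t| + 1) by rewrite normrM ler_wpM2l.
    rewrite ler_norml => /andP[cs1 cs2].
    have := hM (x - c * s + K); rewrite addrK => hMx.
    have {}hMx : `|derive1n 1 phi (x - c * s)| <= M.
      by apply: hMx; rewrite in_itv/= /K; apply/andP; split; lra.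
    rewrite normrM normrN normrM.
    rewrite -[leRHS]mul1r; apply: ler_pM => //; exact: ler_wpM2l.
  have t_in : `]t - 1, t + 1[%classic t by rewrite /= in_itv/=; apply/andP; split; lra.
  have fi (s : R) : `]t - 1, t + 1[%classic s ->
      (@lebesgue_measure R).-integrable `[0, L] (EFin \o f s).
    move=> _; apply: continuous_intble; apply: continuous_fctM => //.
    exact: (@continuous_translate 0).
  have fd (s x : R) : `]t - 1, t + 1[%classic s -> `[0, L]%classic x ->
      derivable (f^~ x) s 1 by move=> _ _; case: (df s x).
  have fb (s x : R) : `]t - 1, t + 1[%classic s -> `[0, L]%classic x ->
      `|partial1of2 f s x| <= `|c| * M.
    by move=> hs hx; rewrite partial1of2E; have [_ ->] := df s x; exact: bd.
  have cint : (@lebesgue_measure R).-integrable `[0, L] (EFin \o (fun=> `|c| * M)).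
    exact: (intble_cst L).
  have mI : measurable (`[0, L]%classic : set (measurableTypeR R)) by exact: measurable_itv.
  apply: DeriveDef.
    exact: (derivable_under_integral mI t_in fi fd (fun=> M0) cint fb).
  rewrite -derive1E (differentiation_under_integral mI t_in fi fd (fun=> M0) cint fb)//.
  apply: eq_Rintegral => x _; rewrite partial1of2E.
  by have [_ ->] := df t x.
split.
- by move=> t _; exact: (sp 0).
- by move=> t _; exact: fin.
- move=> n t _; have [<- <-] := rate t n.
  by split; apply: under_int;
    [exact: continuous_cosm|exact: cosm_norm|exact: continuous_sinm|exact: sinm_norm].
- move=> n; split; apply: cvg_at_right_filter.
  + have h : is_derive (0 : R) 1
      (fun s => integ L (fun x => cosm L n x * phi (x - c * s))) _ :=
      under_int _ 0 (@continuous_cosm R L n) (cosm_norm L n).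
    by apply/differentiable_continuous/derivable1_diffP; case: h.
  + have h : is_derive (0 : R) 1
      (fun s => integ L (fun x => sinm L n x * phi (x - c * s))) _ :=
      under_int _ 0 (@continuous_sinm R L n) (sinm_norm L n).
    by apply/differentiable_continuous/derivable1_diffP; case: h.
Qed.

End Wave.

(** * Two differential inequalities *)

Section Comparison.
Context (R : realType).
Implicit Types (f df : R -> R) (a b t A M : R).

Lemma le_of_derive_le0 f df a b : a <= b ->
  (forall t : R, a < t -> is_derive t 1 f (df t)) ->
  f s @[s --> a^'+] --> f a -> (forall t, a < t -> df t <= 0) -> f b <= f a.
Proof.
rewrite le_eqVlt => /predU1P[->//|ab] dfP fa df0.
have cf t : a < t -> {for t, continuous f}.
  by move=> /dfP [+ _] => /derivable1_diffP /differentiable_continuous.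
have cab : {within `[a, b], continuous f}.
  apply/(continuous_within_itvP _ ab); split => //.
  - by move=> t; rewrite in_itv/= => /andP[/cf].
  - exact/cvg_at_left_filter/cf.
have dfI t : t \in `]a, b[ -> is_derive t 1 f (df t).
  by rewrite in_itv/= => /andP[at_ _]; exact: dfP.
have [t] := MVT ab dfI cab.
rewrite in_itv/= => /andP[at_ _] e; rewrite -subr_le0 e.
by apply: mulr_le0_ge0; [exact: df0 | rewrite subr_ge0 ltW].
Qed.

Variable r : R.
Hypothesis r_gt0 : 0 < r.

Lemma expRD_half t : expR (r / 2 * t) * expR (r / 2 * t) = expR (r * t).
Proof. by rewrite -expRD; congr expR; field. Qed.

Lemma is_derive_expR_lin a (t : R) :
  is_derive t 1 (fun s => expR (a * s)) (a * expR (a * t)).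
Proof. by apply: is_derive_eq; rewrite /GRing.scale/=; ring. Qed.

(** A quantity that starts at zero and whose own growth rate is half that of its
    forcing is bounded by a multiple of the forcing. The integrating factor is
    [expR (- (r / 2) * t)]. *)
Lemma slow_growth_le f df A : 
  (forall t : R, 0 < t -> is_derive t 1 f (df t)) ->
  f s @[s --> 0^'+] --> f 0 -> f 0 <= 0 -> 0 <= A ->
  (forall t, 0 < t -> df t <= r / 2 * f t + A * expR (r * t)) ->
  forall t, 0 <= t -> f t <= 2 * A / r * expR (r * t).
Proof.
move=> fdf f0c f0 A0 hdf t t0.
pose h s := f s * expR (- (r / 2) * s) - 2 * A / r * expR (r / 2 * s).
have dh (s : R) : 0 < s -> is_derive s 1 h
  ((df s - r / 2 * f s) * expR (- (r / 2) * s) - A * expR (r / 2 * s)).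
  move=> s0; have h1 := fdf s s0.
  have h2 := is_derive_expR_lin (- (r / 2)) s.
  have h3 := is_derive_expR_lin (r / 2) s.
  apply: is_derive_eq; rewrite /GRing.scale/=; field.
  by rewrite gt_eqF.
have hE s : expR (r * s) * expR (- (r / 2) * s) = expR (r / 2 * s).
  by rewrite -expRD; congr expR; field.
have e1 s : expR (- (r / 2) * s) * expR (r / 2 * s) = 1.
  by rewrite -expRD -expR0; congr expR; ring.
have ce (a : R) : expR (a * s) @[s --> (0 : R)^'+] --> expR (a * 0).
  have /derivable1_diffP/differentiable_continuous ch :
      derivable (fun s => expR (a * s)) (0 : R) 1 by case: (is_derive_expR_lin a 0).
  by apply: cvg_at_right_filter; exact: ch.
have : h t <= h 0.
  apply: (le_of_derive_le0 t0 dh).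
  - apply: cvgB; first exact: cvgM.
    by apply: cvgM; [exact: cvg_cst | exact: ce].
  - move=> s s0; rewrite subr_le0 -hE mulrA ler_wpM2r ?expR_ge0//.
    by rewrite lerBlDl; exact: hdf.
have -> : h 0 = f 0 - 2 * A / r by rewrite /h !mulr0 expR0 !mulr1.
have K0 : 0 <= 2 * A / r by rewrite divr_ge0 ?mulr_ge0// ltW.
rewrite /h => ht.
have : f t * expR (- (r / 2) * t) <= 2 * A / r * expR (r / 2 * t) by lra.
move=> /(ler_wpM2r (expR_ge0 (r / 2 * t))).
by rewrite -[f t * _ * _]mulrA e1 mulr1 -[_ * expR _ * expR _]mulrA expRD_half.
Qed.

(** The equation [f' = r * f + g] is unstable, so that a solution is recovered
    from its future: integrated backwards from large times, a solution bounded
    below is at least minus a weighted integral of the later forcing, which grows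
    more slowly than [expR (r * t)]. *)
Lemma fast_growth_ge f g A M : 0 <= A -> 0 <= M ->
  (forall t : R, 0 < t -> is_derive t 1 f (r * f t + g t)) ->
  (forall t, 0 < t -> g t <= A * expR (r / 2 * t)) ->
  (forall t, 0 < t -> - M <= f t) ->
  forall t, 0 < t -> - (2 * A / r * expR (r / 2 * t)) <= f t.
Proof.
move=> A0 M0 fdf gA fM t t0.
pose h s := f s * expR (- r * s) + 2 * A / r * expR (- (r / 2) * s).
have dh (s : R) : 0 < s -> is_derive s 1 h
  (g s * expR (- r * s) - A * expR (- (r / 2) * s)).
  move=> s0; have h1 := fdf s s0.
  have h2 := is_derive_expR_lin (- r) s.
  have h3 := is_derive_expR_lin (- (r / 2)) s.
  apply: is_derive_eq; rewrite /GRing.scale/=; field.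
  by rewrite gt_eqF.
have hE s : expR (r / 2 * s) * expR (- r * s) = expR (- (r / 2) * s).
  by rewrite -expRD; congr expR; field.
have hE2 s : expR (- (r / 2) * s) * expR (r * s) = expR (r / 2 * s).
  by rewrite -expRD; congr expR; field.
have e1 s : expR (- r * s) * expR (r * s) = 1.
  by rewrite -expRD -expR0; congr expR; ring.
have dec T : t <= T -> h T <= h t.
  move=> tT; apply: (le_of_derive_le0 tT (df := fun s =>
    g s * expR (- r * s) - A * expR (- (r / 2) * s))).
  - by move=> s ts; apply: dh; exact: lt_trans ts.
  - have /derivable1_diffP/differentiable_continuous ch : derivable h t 1.
      by case: (dh t t0).
    by apply: cvg_at_right_filter; exact: ch.
  - move=> s ts; rewrite subr_le0 -hE mulrA ler_wpM2r ?expR_ge0//.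
    by apply: gA; exact: lt_trans ts.
have K0 : 0 <= 2 * A / r by rewrite divr_ge0 ?mulr_ge0// ltW.
have h0 : 0 <= h t.
  rewrite leNgt; apply/negP => ht.
  have d0 : 0 < - h t by rewrite oppr_gt0.
  (* By the time [T] the bound [M] would be smaller than [- h t] times the
     growth of the integrating factor. *)
  pose T := t + M / - h t / r.
  have md : 0 <= M / - h t / r by rewrite !divr_ge0// ltW.
  have tT : t <= T by rewrite /T lerDl.
  have T0 : 0 < T by exact: lt_le_trans tT.
  have hT : - (M * expR (- r * T)) <= h T.
    rewrite /h -[leLHS]addr0; apply: lerD.
      by rewrite -mulNr ler_wpM2r ?expR_ge0// fM.
    by rewrite mulr_ge0// expR_ge0.
  have lt1 : M < (- h t) * expR (r * T).
    apply: lt_le_trans (ler_wpM2l (ltW d0) (expR_ge1Dx _)).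
    rewrite /T mulrDr mulrDr mulr1 mulrDr.
    have -> : - h t * (r * (M / - h t / r)) = M.
      by field; rewrite (lt_eqF ht) (gt_eqF r_gt0).
    have : 0 <= - h t * (r * t) by rewrite !mulr_ge0// ltW.
    by lra.
  have := le_trans hT (dec T tT).
  move=> /(ler_wpM2r (expR_ge0 (r * T))).
  rewrite mulNr -mulrA e1 mulr1 => hh.
  by rewrite mulNr in lt1; lra.
have := mulr_ge0 h0 (expR_ge0 (r * t)).
rewrite /h mulrDl -[f t * _ * _]mulrA e1 mulr1 -[_ * expR _ * expR _]mulrA hE2.
by lra.
Qed.

Lemma fast_growth_norm_le f g A M : 0 <= A -> 0 <= M ->
  (forall t : R, 0 < t -> is_derive t 1 f (r * f t + g t)) ->
  (forall t, 0 < t -> `|g t| <= A * expR (r / 2 * t)) ->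
  (forall t, 0 < t -> `|f t| <= M) ->
  forall t, 0 < t -> `|f t| <= 2 * A / r * expR (r / 2 * t).
Proof.
move=> A0 M0 fdf gA fM t t0; rewrite ler_norml; apply/andP; split.
  apply: (fast_growth_ge A0 M0 fdf) => // s s0.
    by apply: le_trans (gA s s0); exact: ler_norm.
  by have := fM s s0; rewrite ler_norml => /andP[].
rewrite -[f t]opprK lerNl.
apply: (@fast_growth_ge (fun s => - f s) (fun s => - g s) A M) => // s s0.
- have h := fdf s s0; apply: is_derive_eq; ring.
- by apply: le_trans (gA s s0); rewrite -normrN; exact: ler_norm.
- by rewrite lerN2; have := fM s s0; rewrite ler_norml => /andP[].
Qed.

End Comparison.

(** * Two small solutions cannot differ by a constant at time zero *)

Section Difference.
Context (R : realType) (r alpha L eta : R) (u v : R -> R -> R).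
Implicit Types (n N : nat) (t : R).
Hypotheses (L_gt0 : 0 < L) (r_gt0 : 0 < r) (eta_ge0 : 0 <= eta).
Hypothesis spectral_gap : 15 / 16 * r <= wavenum L 1 ^+ 2.
Hypotheses (u_sol : modal_solution r alpha L u) (v_sol : modal_solution r alpha L v).
Hypothesis uv_small : forall t, 0 < t ->
  ae_period L (fun x => `|u t x| + `|v t x| <= eta).

(* The nonlinear terms of the two equations differ by multiples of [sw] and of
   its derivative. *)
Let w t x : R := u t x - v t x.
Let sw t x : R := (u t x + v t x) * w t x.
Let c n t : R := coscoef L (u t) n - coscoef L (v t) n.
Let s n t : R := sincoef L (u t) n - sincoef L (v t) n.
Let P n t : R := coscoef L (sw t) n.
Let Q n t : R := sincoef L (sw t) n.

Let su t : 0 <= t -> square_intble L (u t).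
Proof. by case: u_sol => h _ _ _; exact: h. Qed.

Let sv t : 0 <= t -> square_intble L (v t).
Proof. by case: v_sol => h _ _ _; exact: h. Qed.

Let w_sq t : 0 <= t -> square_intble L (w t).
Proof. by move=> t0; apply: square_intbleB; [exact: su|exact: sv]. Qed.

Let w_modes n t : 0 <= t -> coscoef L (w t) n = c n t /\ sincoef L (w t) n = s n t.
Proof.
move=> t0; have iu := square_intble_intble (su t0); have iv := square_intble_intble (sv t0).
by rewrite /w (coscoefB _ iu iv) (sincoefB _ iu iv).
Qed.

Let sw_modes n t : 0 <= t ->
  P n t = coscoef L (fun x => u t x ^+ 2) n - coscoef L (fun x => v t x ^+ 2) n /\
  Q n t = sincoef L (fun x => u t x ^+ 2) n - sincoef L (fun x => v t x ^+ 2) n.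
Proof.
move=> t0; have [_ iu] := su t0; have [_ iv] := sv t0.
have e : sw t = (fun x => u t x ^+ 2 - v t x ^+ 2).
  by apply/funext => x; rewrite /sw /w; ring.
by rewrite /P /Q e (coscoefB _ iu iv) (sincoefB _ iu iv).
Qed.

Let mode_derive n t : 0 < t ->
  is_derive t 1 (c n) ((r - wavenum L n ^+ 2) * c n t + wavenum L n ^+ 3 * s n t
    - r * P n t - alpha / 2 * wavenum L n * Q n t) /\
  is_derive t 1 (s n) ((r - wavenum L n ^+ 2) * s n t - wavenum L n ^+ 3 * c n t
    - r * Q n t + alpha / 2 * wavenum L n * P n t).
Proof.
move=> t0; have [-> ->] := sw_modes n (ltW t0).
case: u_sol => _ _ /(_ n t t0) [u1 u2] _; case: v_sol => _ _ /(_ n t t0) [v1 v2] _.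
split; apply: is_derive_eq; rewrite /cos_rate /sin_rate /c /s; ring.
Qed.

Let mode_cvg n :
  c n t @[t --> 0^'+] --> c n 0 /\ s n t @[t --> 0^'+] --> s n 0.
Proof.
case: u_sol => _ _ _ /(_ n) [u1 u2]; case: v_sol => _ _ _ /(_ n) [v1 v2].
by split; apply: cvgB.
Qed.

Let energy t : R := integ L (fun x => w t x ^+ 2).

Let sw_small t : 0 < t ->
  square_intble L (sw t) /\ integ L (fun x => sw t x ^+ 2) <= eta ^+ 2 * energy t.
Proof.
move=> t0; have w2 := w_sq (ltW t0).
have hs : ae_period L (fun x => `|u t x + v t x| <= eta).
  by apply: ae_period_imp (uv_small t0) => x; apply: le_trans; exact: ler_normD.
have ms : meas L (fun x => u t x + v t x).
  by case: (su (ltW t0)) => mu _; case: (sv (ltW t0)) => mv _; exact: measurable_funD.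
have sw2 := square_intble_ae_boundedM ms w2 hs; split => //.
case: (w2) => _ iw; case: (sw2) => _ isw.
rewrite /energy -integZ//; apply: ae_period_le_integ => //; first exact: intbleZ.
apply: ae_period_imp hs => x hx; rewrite /sw exprMn ler_wpM2r ?sqr_ge0//.
by rewrite -(real_normK (num_real (u t x + v t x))) lerXn2r ?nnegrE.
Qed.

Let D : R := 8 * r + alpha ^+ 2.

Let D_ge0 : 0 <= D. Proof. by rewrite /D addr_ge0 ?sqr_ge0// mulr_ge0// ltW. Qed.

(** The dispersive terms cancel. Young's inequality gives an eighth of [r] and a
    quarter of [wavenum L n.+1 ^+ 2] to the mode, and the gap leaves a growth rate
    of at most [r / 2]. *)
Let mode_energy_le n t :
  2 * (c n.+1 t * ((r - wavenum L n.+1 ^+ 2) * c n.+1 t + wavenum L n.+1 ^+ 3 * s n.+1 t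
    - r * P n.+1 t - alpha / 2 * wavenum L n.+1 * Q n.+1 t) +
  s n.+1 t * ((r - wavenum L n.+1 ^+ 2) * s n.+1 t - wavenum L n.+1 ^+ 3 * c n.+1 t
    - r * Q n.+1 t + alpha / 2 * wavenum L n.+1 * P n.+1 t)) <=
  r / 2 * (c n.+1 t ^+ 2 + s n.+1 t ^+ 2) + D * (P n.+1 t ^+ 2 + Q n.+1 t ^+ 2).
Proof.
have gap : 15 / 16 * r <= wavenum L n.+1 ^+ 2.
  apply: le_trans spectral_gap _; rewrite (wavenum_nat L n.+1).
  by move: (wavenum L 1) => k1; rewrite exprMn ler_peMr ?sqr_ge0// exprn_ege1// ler1n.
move: gap; set k := wavenum L n.+1; set a := c _ _; set b := s _ _.
set p := P _ _; set q := Q _ _ => gap.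
have y1 : 0 <= r * ((a / 4 + 2 * p) ^+ 2 + (b / 4 + 2 * q) ^+ 2).
  by rewrite mulr_ge0 ?addr_ge0 ?sqr_ge0// ltW.
have y2 : 0 <= (k * a / 2 + alpha * q) ^+ 2 + (k * b / 2 - alpha * p) ^+ 2.
  by rewrite addr_ge0 ?sqr_ge0.
have y3 : 0 <= (k ^+ 2 - 15 / 16 * r) * (a ^+ 2 + b ^+ 2).
  by apply: mulr_ge0; [rewrite subr_ge0 | rewrite addr_ge0 ?sqr_ge0].
have y4 : 0 <= r * (a ^+ 2 + b ^+ 2).
  by rewrite mulr_ge0 ?addr_ge0 ?sqr_ge0// ltW.
have y5 : 0 <= alpha ^+ 2 * (p ^+ 2 + q ^+ 2).
  by rewrite mulr_ge0 ?addr_ge0 ?sqr_ge0.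
rewrite /D; lra.
Qed.

Let tail N t : R := \sum_(n < N) (c n.+1 t ^+ 2 + s n.+1 t ^+ 2).

Hypothesis w0_const : exists2 d : R, 0 < d & forall x, w 0 x = d.

Let tail0 N : tail N 0 = 0.
Proof.
have [d d0 wd] := w0_const.
apply: big1 => n _; have [<- <-] := w_modes n.+1 (lexx 0).
have -> : w 0 = fun=> d by exact/funext.
have -> : coscoef L (fun=> d) n.+1 = 0.
  rewrite /coscoef; under eq_fun do rewrite mulrC.
  by rewrite integZ ?integ_cosm ?mulr0//; exact: intble_cosm.
have -> : sincoef L (fun=> d) n.+1 = 0.
  rewrite /sincoef; under eq_fun do rewrite mulrC.
  by rewrite integZ ?integ_sinm ?mulr0//; exact: intble_sinm.
by rewrite !expr0n addr0.
Qed.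

Let modal_energyE N t : 0 <= t ->
  modal_energy L (w t) N.+1 = L^-1 * c 0 t ^+ 2 + 2 / L * tail N t.
Proof.
move=> t0; rewrite /modal_energy big_ord_recl/= sincoef0// expr0n addr0.
have [-> _] := w_modes 0 t0; congr (_ + _).
rewrite /tail mulr_sumr; apply: eq_bigr => n _.
by rewrite (_ : fintype.bump 0 n = n.+1)//; have [-> ->] := w_modes n.+1 t0.
Qed.

(** The difference [w] solves a linear equation whose coefficients, of size
    [eta], are the sum of the two solutions. An [L^2] bound on [w] growing like
    [expR (r / 2 * t)] is thus improved: the oscillating modes start at zero and
    grow no faster than their forcing, and the mean, which is expelled at the
    rate [r], can only stay bounded by being slaved to its forcing. *)
Lemma contraction (Z : R) : 0 <= Z ->
  eta ^+ 2 * (4 + 2 * D / r) <= 4^-1 ->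
  (forall t, 0 < t -> energy t <= Z ^+ 2 * expR (r * t)) ->
  forall t, 0 < t -> energy t <= (Z / 2) ^+ 2 * expR (r * t).
Proof.
move=> Z0 eta_small hZ.
have L0 := ltW L_gt0; have r0 := ltW r_gt0.
have forcing N t : 0 < t -> L^-1 * P 0 t ^+ 2 +
    2 / L * \sum_(n < N) (P n.+1 t ^+ 2 + Q n.+1 t ^+ 2)
    <= eta ^+ 2 * Z ^+ 2 * expR (r * t).
  move=> t0; have [sw2 hsw] := sw_small t0.
  apply: le_trans (_ : eta ^+ 2 * energy t <= _); last first.
    by rewrite -mulrA ler_wpM2l ?sqr_ge0// hZ.
  apply: le_trans hsw; apply: le_trans (bessel L_gt0 N.+1 sw2).
  rewrite /modal_energy big_ord_recl/= sincoef0// expr0n addr0 lerD2l.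
  by rewrite mulr_sumr.
have sumPQ0 N t : 0 <= \sum_(n < N) (P n.+1 t ^+ 2 + Q n.+1 t ^+ 2).
  by apply: sumr_ge0 => n _; rewrite addr_ge0 ?sqr_ge0.
have Li0 : 0 < L^-1 by rewrite invr_gt0.
pose A := D * (L / 2 * (eta ^+ 2 * Z ^+ 2)).
have A0 : 0 <= A by rewrite /A !mulr_ge0 ?sqr_ge0.
have tail_le N t : 0 <= t -> tail N t <= 2 * A / r * expR (r * t).
  move: t; apply: (@slow_growth_le R r r_gt0 (tail N) (fun t => \sum_(n < N)
   (2 * (c n.+1 t * ((r - wavenum L n.+1 ^+ 2) * c n.+1 t + wavenum L n.+1 ^+ 3 * s n.+1 t
    - r * P n.+1 t - alpha / 2 * wavenum L n.+1 * Q n.+1 t) +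
  s n.+1 t * ((r - wavenum L n.+1 ^+ 2) * s n.+1 t - wavenum L n.+1 ^+ 3 * c n.+1 t
    - r * Q n.+1 t + alpha / 2 * wavenum L n.+1 * P n.+1 t)))) A) => //.
  - move=> t t0; rewrite /tail; elim: N => [|N IH].
      have -> : (fun t => \sum_(n < 0) (c n.+1 t ^+ 2 + s n.+1 t ^+ 2)) = fun=> 0.
        by apply/funext => y; rewrite big_ord0.
      by rewrite big_ord0; exact: is_derive_cst.
    have -> : (fun t => \sum_(n < N.+1) (c n.+1 t ^+ 2 + s n.+1 t ^+ 2)) =
      fun t => \sum_(n < N) (c n.+1 t ^+ 2 + s n.+1 t ^+ 2) +
        (c N.+1 t * c N.+1 t + s N.+1 t * s N.+1 t).
      by apply/funext => y; rewrite big_ord_recr/= !expr2.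
    have [h1 h2] := mode_derive N.+1 t0.
    apply: is_derive_eq; rewrite big_ord_recr/= /GRing.scale/=; congr (_ + _).
    by ring.
  - rewrite /tail; elim: N => [|N IH].
      by under eq_fun do rewrite big_ord0; rewrite big_ord0; exact: cvg_cst.
    under eq_fun do rewrite big_ord_recr/=.
    rewrite big_ord_recr/=; apply: cvgD => //.
    have [h1 h2] := mode_cvg N.+1; rewrite !expr2.
    by under eq_fun do rewrite !expr2; apply: cvgD; apply: cvgM.
  - by rewrite tail0.
  - move=> t t0; rewrite /tail mulr_sumr.
    apply: (@le_trans _ _ (\sum_(n < N) (r / 2 * (c n.+1 t ^+ 2 + s n.+1 t ^+ 2)
       + D * (P n.+1 t ^+ 2 + Q n.+1 t ^+ 2)))).
      by apply: ler_sum => n _; exact: mode_energy_le.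
    rewrite big_split/= lerD2l -mulr_sumr /A -mulrA ler_wpM2l//.
    have := forcing N t t0; set S := \sum_(_ < _) _ => hS.
    have : 2 / L * S <= eta ^+ 2 * Z ^+ 2 * expR (r * t).
      by apply: le_trans hS; rewrite lerDr mulr_ge0 ?sqr_ge0// ltW.
    move=> /(ler_wpM2l (divr_ge0 L0 (ler0n R 2))).
    have -> : L / 2 * (2 / L * S) = S by field; rewrite gt_eqF.
    by lra.
have sq0 : 0 <= Num.sqrt L by exact: sqrtr_ge0.
pose A' := r * (Num.sqrt L * (eta * Z)).
have A'0 : 0 <= A' by rewrite /A' !mulr_ge0.
have mean_le t : 0 < t -> c 0 t ^+ 2 <= 4 * L * (eta ^+ 2 * Z ^+ 2) * expR (r * t).
  move=> t0.
  have w0 : wavenum L 0 = 0 by rewrite wavenum0.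
  have : `|c 0 t| <= 2 * A' / r * expR (r / 2 * t).
    move: t t0; apply: (@fast_growth_norm_le R r r_gt0 (c 0) (fun t => - (r * P 0 t))
      A' (L * eta)) => //.
    - by rewrite mulr_ge0.
    - move=> t t0; have [h _] := mode_derive 0 t0.
      by apply: is_derive_eq; rewrite w0; ring.
    - move=> t t0; rewrite normrN normrM ger0_norm// /A' -mulrA ler_wpM2l//.
      rewrite -(ler_pXn2r (n := 2)) ?nnegrE ?mulr_ge0 ?expR_ge0//.
      rewrite real_normK ?num_real// !exprMn sqr_sqrtr//.
      have := forcing 0 t t0; rewrite big_ord0 mulr0 addr0 ler_pdivrMl//.
      by rewrite -(expRD_half r t) => /le_trans; apply; rewrite le_eqVlt; apply/orP; left;
         apply/eqP; ring.
    - move=> t t0; have [<- _] := w_modes 0 (ltW t0).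
      rewrite mulrC; apply: ae_period_integ_norm => //.
        by apply: intble_cosmM; apply: square_intble_intble; exact: w_sq (ltW t0).
      apply: ae_period_imp (uv_small t0) => x; rewrite cosm0 mul1r; apply: le_trans.
      exact: ler_normB.
  have -> : 2 * A' / r = 2 * (Num.sqrt L * (eta * Z)) by rewrite /A'; field; rewrite gt_eqF.
  move=> h; have : `|c 0 t| ^+ 2 <= (2 * (Num.sqrt L * (eta * Z)) * expR (r / 2 * t)) ^+ 2.
    by rewrite lerXn2r ?nnegrE ?mulr_ge0 ?expR_ge0.
  rewrite real_normK ?num_real// !exprMn sqr_sqrtr// -(expRD_half r t).
  by move=> /le_trans; apply; rewrite le_eqVlt; apply/orP; left; apply/eqP; ring.
move=> t t0; have t00 := ltW t0.
have decay : exists B, coef_decay L B (w t).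
  have [xu xu0 hu] : exists2 x : R, 0 <= x & (Hnorm 3 L (u t) <= x%:E)%E.
    by case: u_sol => _ /(_ t t00).
  have [xv xv0 hv] : exists2 x : R, 0 <= x & (Hnorm 3 L (v t) <= x%:E)%E.
    by case: v_sol => _ /(_ t t00).
  have [B0 hB] := decay_of_Hnorm3 L_gt0 xu0 hu.
  have [B'0 hB'] := decay_of_Hnorm3 L_gt0 xv0 hv.
  exists (2 * (Num.sqrt L * xu + Num.sqrt L * xv)); split.
    by rewrite mulr_ge0// addr_ge0.
  move=> n; have [-> ->] := w_modes n t00; rewrite /c /s.
  move: (hB n) (hB' n) B0 B'0; set B := Num.sqrt L * xu; set B' := Num.sqrt L * xv.
  rewrite !expr_div_n => h1 h2 B0 B'0.
  set y := (1 + n%:R ^+ 2) ^+ 2 in h1 h2 *.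
  have y0 : 0 < y by rewrite exprn_gt0// ltr_pwDl ?sqr_ge0.
  rewrite ler_pdivlMr// in h1; rewrite ler_pdivlMr// in h2; rewrite ler_pdivlMr//.
  move: h1 h2; set a := coscoef _ (u t) _; set b := sincoef _ (u t) _.
  set a' := coscoef _ _ _; set b' := sincoef _ _ _ => h1 h2.
  have BB : 0 <= B * B' by exact: mulr_ge0.
  have : 0 <= ((a + a') ^+ 2 + (b + b') ^+ 2) * y.
    by rewrite mulr_ge0 ?addr_ge0 ?sqr_ge0// ltW.
  have := sqr_ge0 B; have := sqr_ge0 B'; lra.
have [B hB] := decay.
apply: (integ_sqr_le_of_modal_energy L_gt0 (w_sq t00) hB) => -[|N].
  by rewrite /modal_energy big_ord0 mulr_ge0 ?sqr_ge0 ?expR_ge0.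
rewrite modal_energyE//.
have h1 := mean_le t t0; have h2 := tail_le N t t00.
have h3 : L^-1 * c 0 t ^+ 2 <= 4 * eta ^+ 2 * (Z ^+ 2 * expR (r * t)).
  rewrite ler_pdivrMl//; apply: le_trans h1 _.
  by rewrite le_eqVlt; apply/orP; left; apply/eqP; ring.
have h4 : 2 / L * tail N t <= 2 * D / r * eta ^+ 2 * (Z ^+ 2 * expR (r * t)).
  have := ler_wpM2l (divr_ge0 (ler0n R 2) L0) h2; move=> /le_trans; apply.
  rewrite le_eqVlt; apply/orP; left; apply/eqP; rewrite /A; field.
  by rewrite !gt_eqF.
apply: le_trans (lerD h3 h4) _; rewrite -mulrDl.
have -> : (Z / 2) ^+ 2 * expR (r * t) = 4^-1 * (Z ^+ 2 * expR (r * t)) by field.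
apply: ler_wpM2r; first by rewrite mulr_ge0 ?sqr_ge0 ?expR_ge0.
by apply: le_trans eta_small; rewrite le_eqVlt; apply/orP; left; apply/eqP; ring.
Qed.

Let mean_eq0 : eta ^+ 2 * (4 + 2 * D / r) <= 4^-1 -> forall t, 0 < t -> c 0 t = 0.
Proof.
move=> eta_small t t0; have L0 := ltW L_gt0.
have iter j : forall t, 0 < t ->
    energy t <= (Num.sqrt L * eta / 2 ^+ j) ^+ 2 * expR (r * t).
  elim: j => [|j IH] y y0.
    rewrite expr0 divr1 exprMn sqr_sqrtr// mulrC.
    have ie : energy y <= eta ^+ 2 * L.
      apply: le_trans (ler_norm _) _; apply: ae_period_integ_norm => //.
        by case: (w_sq (ltW y0)).
      apply: ae_period_imp (uv_small y0) => x hx.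
      have hw : `|w y x| <= eta by apply: le_trans hx; exact: ler_normB.
      by rewrite normrX lerXn2r ?nnegrE.
    apply: le_trans ie _; rewrite [L * _]mulrC -[leLHS]mul1r ler_wpM2r//.
      by rewrite mulr_ge0 ?sqr_ge0.
    by apply: le_trans (expR_ge1Dx _); rewrite lerDl mulr_ge0// ltW.
  rewrite [2 ^+ j.+1]exprSr invfM mulrA; apply: contraction => //.
  by rewrite divr_ge0 ?exprn_ge0// mulr_ge0 ?sqrtr_ge0.
apply/eqP; rewrite -sqrf_eq0; apply/eqP.
apply: (@eq0_of_le_harmonic _ _ (L * (L * eta ^+ 2) * expR (r * t))) => j.
rewrite ger0_norm ?sqr_ge0//.
have := bessel L_gt0 1 (w_sq (ltW t0)); rewrite modal_energyE ?(ltW t0)//.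
rewrite /tail big_ord0 mulr0 addr0 => h1.
have h2 := le_trans h1 (iter j t t0).
rewrite ler_pdivrMl ?invr_gt0// in h2; apply: le_trans h2 _.
rewrite expr_div_n exprMn sqr_sqrtr//.
have -> : L * (L * eta ^+ 2 / (2 ^+ j) ^+ 2 * expR (r * t)) =
  L * (L * eta ^+ 2) * expR (r * t) * ((2 ^+ j) ^+ 2)^-1 by ring.
apply: ler_wpM2l; first by rewrite !mulr_ge0 ?sqr_ge0 ?expR_ge0.
have p0 : 1 <= 2 ^+ j :> R by rewrite exprn_ege1// ler1n.
rewrite lef_pV2 ?posrE ?exprn_gt0//.
have : j.+1%:R <= 2 ^+ j :> R by rewrite -natrX ler_nat ltn_expl.
by move: p0; set p := 2 ^+ j; set q := j.+1%:R => p0 pq; rewrite expr2; nra.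
Qed.

(** By iteration of [contraction] the two solutions coincide at all positive
    times, and the mean of their difference is continuous at time zero. *)
Lemma small_pair_absurd : eta ^+ 2 * (4 + 2 * D / r) <= 4^-1 -> False.
Proof.
move=> eta_small; have [d d0 wd] := w0_const.
have c00 : c 0 0 = d * L.
  have [<- _] := w_modes 0 (lexx 0).
  have -> : w 0 = fun=> d by exact/funext.
  rewrite /coscoef; under eq_fun do rewrite cosm0 mul1r.
  by rewrite integ_cst.
have [cc _] := mode_cvg 0.
have c0 : c 0 0 = 0.
  have c1 : c 0 t @[t --> (0 : R)^'+] --> (0 : R).
    by apply: cvg_near_cst; near=> t; apply: mean_eq0 => //; near: t; exact: nbhs_right_gt.
  exact: (cvg_unique _ cc c1).
by have : 0 < d * L by [exact: mulr_gt0]; rewrite -c00 c0 ltxx.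
Unshelve. all: by end_near. Qed.

End Difference.

(** * Instability of small waves *)

Lemma Hnorm3_cst_le (R : realType) (L d : R) : 0 < L -> 0 <= d ->
  (Hnorm 3 L (fun=> d) <= (Num.sqrt L * d)%:E)%E.
Proof.
move=> L0 d0.
have -> : Num.sqrt L * d = Num.sqrt (L * d ^+ 2).
  by rewrite sqrtrM ?(ltW L0)// sqrtr_sqr ger0_norm.
have Ld : 0 <= L * d ^+ 2 by rewrite mulr_ge0 ?sqr_ge0// ltW.
apply: Hnorm_le => //; first exact: intble_cst.
have cE (n : nat) : coscoef L (fun=> d) n = if n is 0%N then d * L else 0.
  rewrite /coscoef; under eq_fun do rewrite mulrC.
  rewrite integZ; last exact: intble_cosm.
  by rewrite integ_cosm//; case: n => [|n]; rewrite ?eqxx ?mulr0.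
have sE (n : nat) : sincoef L (fun=> d) n = 0.
  rewrite /sincoef; under eq_fun do rewrite mulrC.
  by rewrite integZ ?integ_sinm ?mulr0//; exact: intble_sinm.
case=> [|N]; first by rewrite big_ord0.
rewrite big_ord_recl big1 ?addr0; last first.
  by move=> n _; rewrite lift0 cE sE expr0n addr0 !mulr0.
rewrite /= cE sE !expr0n/= addr0 expr1n mul1r addr0.
by rewrite le_eqVlt; apply/orP; left; apply/eqP; field; rewrite gt_eqF.
Qed.

Section SmallWave.
Context (R : realType) (r alpha c L m : R) (phi : R -> R).
Hypotheses (r_gt0 : 0 < r) (wave : periodic_wave r alpha c L phi).
Hypothesis spectral_gap : 15 / 16 * r <= wavenum L 1 ^+ 2.
Hypothesis phi_le : forall x, `|phi x| <= m.
Hypothesis m_small : (4 * m) ^+ 2 * (4 + 2 * (8 * r + alpha ^+ 2) / r) <= 4^-1.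

(** The wave is perturbed by a small constant. A solution that stays close to the
    orbit is itself small, and [small_pair_absurd] applies to it and to the wave:
    following the orbit up to translations is enough, since only smallness of
    the solution is needed, not its phase. *)
Lemma small_wave_unstable : 0 < m -> orbitally_unstable r alpha L phi.
Proof.
move=> m0 stable.
have L0 : 0 < L by case: wave => _ [].
have s0 : 0 < Num.sqrt L by rewrite sqrtr_gt0.
(* This distance in [H^3] gives a distance [2 * m] in the sup norm, so that the
   solution is at most [3 * m] and the sum of both at most [4 * m]. *)
have e0 : 0 < Num.sqrt L * m / 8 by rewrite divr_gt0// mulr_gt0.
have [delta delta0 hdelta] := stable _ e0.
pose d := delta / (2 * Num.sqrt L).
have d0 : 0 < d by rewrite divr_gt0// mulr_gt0.
have psiH : Hper 3 L (fun x => phi x + d).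
  by have := translate_Hper wave 0 d; under eq_fun do rewrite subr0.
have dist : (orbit_dist L phi (fun x => phi x + d)%R < delta%:E)%E.
  apply: (@le_lt_trans _ _ (Hnorm 3 L (fun=> d))).
    apply: ereal_inf_lbound; exists 0 => //.
    by congr Hnorm; apply/funext => x; rewrite addr0; ring.
  apply: le_lt_trans (Hnorm3_cst_le L0 (ltW d0)) _; rewrite lte_fin /d.
  have -> : Num.sqrt L * (delta / (2 * Num.sqrt L)) = delta / 2.
    by field; rewrite gt_eqF.
  by lra.
have [u [usol u0 usup]] := hdelta _ psiH dist.
have umod := global_solution_modal L0 usol.
have vmod := wave_modal_solution wave.
apply: (@small_pair_absurd R r alpha L (4 * m) u (fun t x => phi (x - c * t))) => //.
- by rewrite mulr_ge0// ltW.
- move=> t t0.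
  have near_orbit : (orbit_dist L phi (u t) < (Num.sqrt L * m / 8)%:E)%E.
    by apply: le_lt_trans usup; apply: ereal_sup_ubound; exists t.
  have [_ [rho _ <-] hrho] := ereal_inf_lt near_orbit.
  have su : square_intble L (u t) by case: umod => h _ _ _; exact: h (ltW t0).
  have sp : square_intble L (fun x => phi (x + rho)).
    have := @continuous_translate R r alpha c L phi wave 0 (- rho).
    move=> /(continuous_square_intble L); congr square_intble.
    by apply/funext => x; rewrite opprK.
  have := ae_bounded_of_Hnorm3 L0 (square_intble_intble (square_intbleB su sp))
    (ltW e0) (ltW hrho).
  apply: ae_period_imp => x hx.
  have {}hx : `|u t x - phi (x + rho)| <= 2 * m.
    apply: le_trans hx _.
    rewrite le_eqVlt; apply/orP; left; apply/eqP; field; rewrite gt_eqF//.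
  have := ler_normD (u t x - phi (x + rho)) (phi (x + rho)); rewrite subrK.
  by have := phi_le (x + rho); have := phi_le (x - c * t); lra.
- exists d => // x; rewrite u0 mulr0 subr0; ring.
Qed.

End SmallWave.

Theorem theorem4p4 (R : realType) (r alpha : R) (r_gt0 : 0 < r)
    (alpha_gt0 : 0 < alpha) (eps0 : R) (eps0_gt0 : 0 < eps0)
    (c Lp : R -> R) (phi : R -> R -> R)
    (family : hopf_family r alpha eps0 c Lp phi) :
  exists2 eps1 : R, 0 < eps1 < eps0 &
    forall eps : R, 0 < eps < eps1 ->
      orbitally_unstable r alpha (Lp eps) (phi eps).
Proof.
case: family => waves period _ [M hM] _.
pose X : R := 4 + 2 * (8 * r + alpha ^+ 2) / r.
have X4 : 4 <= X by rewrite lerDl !mulr_ge0 ?addr_ge0 ?sqr_ge0 ?invr_ge0 ?mulr_ge0 ?(ltW r_gt0).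
pose m : R := (16 * X)^-1.
have X0 : 0 < X by lra.
have m0 : 0 < m by rewrite invr_gt0 mulr_gt0.
have m_small : (4 * m) ^+ 2 * X <= 4^-1.
  have -> : (4 * m) ^+ 2 * X = m by rewrite /m; field; rewrite gt_eqF.
  by rewrite /m lef_pV2 ?posrE ?mulr_gt0//; lra.
have near_amp : \forall eps \near (0 : R)^'+, M * Num.sqrt eps <= m.
  have c1 : M * Num.sqrt eps @[eps --> (0 : R)^'+] --> M * Num.sqrt 0.
    apply: cvgM; first exact: cvg_cst.
    exact/cvg_at_right_filter/sqrt_continuous.
  rewrite sqrtr0 mulr0 in c1; exact: cvgr_le c1 _ m0.
pose T : R := 2 * pi / Num.sqrt r.
have sr0 : 0 < Num.sqrt r by rewrite sqrtr_gt0.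
have T0 : 0 < T by rewrite /T divr_gt0// mulr_gt0// pi_gt0.
(* The ratio is chosen so that (32 / 33) ^ 2 is at least 15 / 16. *)
have near_period : \forall eps \near (0 : R)^'+, Lp eps <= 33 / 32 * T.
  have [k k0 hk] : exists2 k : R, 0 < k & \forall eps \near (0 : R)^'+,
      `|Lp eps - T| <= k * `|eps|.
    by have [k k0 hk] := (eqO_exP _ _ _).1 period; exists k.
  have : \forall eps \near (0 : R)^'+, k * `|eps| <= T / 32.
    have T32 : 0 < T / 32 by rewrite divr_gt0.
    have c1 : k * `|eps| @[eps --> (0 : R)^'+] --> k * `|0 : R|.
      apply: cvgM; first exact: cvg_cst.
      by apply: cvg_norm; apply: cvg_at_right_filter; exact: cvg_id.
    rewrite normr0 mulr0 in c1; exact: cvgr_le c1 _ T32.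
  move: hk; apply: filterS2 => eps h1 h2.
  by have := ler_norm (Lp eps - T); lra.
have : \forall eps \near (0 : R)^'+, (M * Num.sqrt eps <= m /\ Lp eps <= 33 / 32 * T) /\
    forall x : R, `|phi eps x| <= M * Num.sqrt eps /\
        `|derive1 (phi eps) x| <= M * Num.sqrt eps.
  exact: filterI (filterI near_amp near_period) hM.
rewrite /at_right near_withinE => /nbhs_ballP[del /= del0 hdel].
exists (Num.min del (eps0 / 2)).
  by rewrite lt_min del0 divr_gt0//= gt_min; apply/orP; right; lra.
move=> eps /andP[e0]; rewrite lt_min => /andP[edel eeps0].
have [|[amp per] bnd] := hdel eps _ e0.
  by rewrite /ball/= sub0r normrN gtr0_norm.
have wave : periodic_wave r alpha (c eps) (Lp eps) (phi eps).
  by apply: waves; rewrite e0; lra.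
have L0 : 0 < Lp eps by case: wave => _ [].
apply: (small_wave_unstable r_gt0 wave _ _ m_small m0).
- rewrite /wavenum mulr1.
  have h : Num.sqrt r * (32 / 33) <= 2 * pi / Lp eps.
    rewrite ler_pdivlMr//; have := ler_wpM2l (ltW sr0) per.
    have -> : Num.sqrt r * (33 / 32 * T) = 33 / 32 * (2 * pi).
      by rewrite /T; field; rewrite gt_eqF.
    by lra.
  have : (Num.sqrt r * (32 / 33)) ^+ 2 <= (2 * pi / Lp eps) ^+ 2.
    have h0 : 0 <= Num.sqrt r * (32 / 33) by rewrite mulr_ge0 ?(ltW sr0)//; lra.
    by rewrite lerXn2r ?nnegrE ?(le_trans h0).
  by rewrite exprMn sqr_sqrtr ?(ltW r_gt0)//; lra.
- by move=> x; apply: le_trans amp; have [] := bnd x.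
Qed.
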